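(* As $n \to \infty$, $$\frac{2}{3\sqrt{3}}\, n^{3/2}(1+o(1)) \le ex(n, \{C_5, K_{2,2}\text{-ind}\}) \le \frac{n^{3/2}}{2}(1+o(1)).$$
   Context: All graphs are finite and simple. $C_5$ is the cycle of length $5$ and $K_{2,2}$ is the complete bipartite graph with both parts of size $2$ (i.e. the $4$-cycle). For graphs $H$ and $F$, $ex(n, \{H, F\text{-ind}\})$ denotes the maximum number of edges in an $n$-vertex graph that contains no copy of $H$ as a (not necessarily induced) subgraph and no induced subgraph isomorphic to $F$. *)

(* Defs.v *)
From HB Require Import structures.
From mathcomp Require Import all_boot.

Set Implicit Arguments.
Unset Strict Implicit.
Unset Printing Implicit Defensive.

Record sgraph (V : finType) := SGraph {
  edges : {set {set V}};
  edges_card2 : [forall e in edges, #|e| == 2]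
}.

HB.instance Definition _ (V : finType) := [isSub for @edges V].
HB.instance Definition _ (V : finType) := [Finite of sgraph V by <:].

Definition adj (V : finType) (G : sgraph V) : rel V :=
  fun x y => [set x; y] \in edges G.

(* The graph in which x and y are adjacent iff x != y and r x y or r y x. *)
Section GraphOfRel.
Variables (V : finType) (r : rel V).

Definition rel_edges : {set {set V}} :=
  [set [set x; y] | x in V, y in V & (x != y) && r x y].

Lemma rel_edges_card2 : [forall e in rel_edges, #|e| == 2].
Proof.
apply/forall_inP => e /imset2P[x y _]; rewrite inE => /andP[_ /andP[xy _]] ->.
by rewrite cards2 xy.
Qed.

Definition graph_of_rel : sgraph V := SGraph rel_edges_card2.

End GraphOfRel.

(* The cycle of length n when 3 <= n; ordS is the successor modulo n. *)
Definition cycle_graph (n : nat) : sgraph 'I_n :=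
  graph_of_rel (fun i j => j == ordS i).

Definition complete_bipartite (s t : nat) : sgraph ('I_s + 'I_t)%type :=
  graph_of_rel (fun u v => if (u, v) is (inl _, inr _) then true else false).

Definition has_copy (W V : finType) (H : sgraph W) (G : sgraph V) : bool :=
  [exists f : {ffun W -> V}, injectiveb f &&
    [forall x, forall y, adj H x y ==> adj G (f x) (f y)]].

Definition has_induced_copy (W V : finType) (F : sgraph W) (G : sgraph V) :
    bool :=
  [exists f : {ffun W -> V}, injectiveb f &&
    [forall x, forall y, adj F x y == adj G (f x) (f y)]].

(* ex(n, {H, F-ind}).  The vertex set is 'I_n without loss of generality.  The
   maximum is 0 by convention when no graph qualifies; this does not happen when
   H and F each have an edge, since the edgeless graph then qualifies. *)
Definition ex_ind (W U : finType) (n : nat) (H : sgraph W) (F : sgraph U) :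
    nat :=
  \max_(G : sgraph 'I_n | ~~ has_copy H G && ~~ has_induced_copy F G)
    #|edges G|.

(* Main.v *)
(* Upper bound. After deleting vertices of bounded degree, two non-adjacent
   vertices have at most two common neighbours (three of them would span a
   5-cycle). Call {x, y} double when it has two of them, and null when it has
   none. If {x, y} is double and b is a neighbour of y but not of x, then {x, b}
   is null, and b arises in this way from at most deg x vertices y; hence the
   sum of deg y / deg x over double pairs is at most about the number of null
   pairs, and since t + 1/t >= 2 there are no more double pairs than null ones.
   So the number of paths of length two is at most n^2 / 2 (1 + o(1)), and
   convexity gives the bound on the number of edges.

   Lower bound. In the point-line incidence graph of the affine plane over F_p,
   replace every line by two adjacent twins: this gives 3 p^2 vertices and more
   than 2 p^3 edges. To reach every n one needs primes in the intervals
   (x, (1 + eps) x] for large x. These come from Selberg's symmetry formula by a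
   variant of an argument of Erdos. Say that H is admissible if psi has positive
   mass on (N, e^H N], uniformly in N. If H < 2 h and (N, e^h N] had almost no
   mass, then for most n the interval (N / n, e^h N / n] would have density 2;
   admissibility of H provides such n with consecutive ratios at most about e^H,
   so the union of these intervals has logarithmic density above 1, contradicting
   Mertens' theorem. Hence h is admissible, and so is every positive real. *)

Require Import Defs.
From mathcomp Require Import all_boot all_order all_algebra.
From mathcomp Require Import ring lra zify.
From mathcomp Require reals sequences exp boolp.
Set Implicit Arguments.
Unset Strict Implicit.
Unset Printing Implicit Defensive.
Import Order.TTheory GRing.Theory Num.Theory.

(** * Graphs without C5 and without induced C4 *)

(** The five pairs required to be distinct are the non-consecutive ones; consecutive vertices differ
    because the relations considered are irreflexive. *)
Definition C5_free (T : finType) (e : rel T) := forall a b c d f : T,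
  a != c -> a != d -> b != d -> b != f -> c != f ->
  e a b -> e b c -> e c d -> e d f -> e f a -> False.

Definition induced_C4_free (T : finType) (e : rel T) := forall a b c d : T,
  a != c -> b != d -> e a b -> e b c -> e c d -> e d a -> e a c || e b d.

Section Upper.
Variables (T : finType) (e : rel T).
Hypotheses (e_sym : symmetric e) (e_irr : irreflexive e).
Hypotheses (C5f : C5_free e) (C4f : induced_C4_free e).

Definition degree (x : T) := #|e x|.
Definition codegree (x y : T) := #|[set z | e x z && e y z]|.
Definition double (x y : T) := [&& x != y, ~~ e x y & 1 < codegree x y].
Definition null (x y : T) := [&& x != y, ~~ e x y & codegree x y == 0].

Lemma e_neq x y : e x y -> x != y.
Proof. by move=> exy; apply: contraTneq exy => ->; rewrite e_irr. Qed.

Lemma codegree_sym x y : codegree x y = codegree y x.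
Proof. by apply: eq_card => z; rewrite !inE andbC. Qed.

Lemma double_sym x y : double x y = double y x.
Proof. by rewrite /double eq_sym e_sym codegree_sym. Qed.

(** Otherwise [x u y v] would be an induced 4-cycle. *)
Lemma common_adj x y u v : x != y -> ~~ e x y -> u != v ->
  e x u -> e y u -> e x v -> e y v -> e u v.
Proof.
move=> xy nxy uv xu yu xv yv.
have := C4f xy uv xu; rewrite e_sym yu yv e_sym xv (negbTE nxy) /=; exact.
Qed.

(** Of three common neighbours [u], [v], [w] the first two are adjacent, which closes the 5-cycle
    [x u v y w]. *)
Lemma codegree_le2 x y : x != y -> ~~ e x y -> codegree x y <= 2.
Proof.
move=> xy nxy; rewrite leqNgt; apply/negP => /card_gt2P[u [v [w [[]]]]].
rewrite !inE => /andP[xu yu] /andP[xv yv] /andP[xw yw] [uv vw wu].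
have euv := common_adj xy nxy uv xu yu xv yv.
apply: (@C5f x u v y w); rewrite ?(e_neq xv) // 1?e_sym // 1?eq_sym ?(e_neq yu) //.
Qed.

(** If [x] and [b] had a common neighbour [a], a common neighbour [u] of [x] and [y] other than [a]
    would close the 5-cycle [x a b y u]. *)
Lemma double_null x y b : double x y -> e y b -> ~~ e x b -> null x b.
Proof.
move=> /and3P[xy nxy cxy] yb nxb.
have xb : x != b by apply: contraNneq nxy => ->; rewrite e_sym.
rewrite /null xb nxb /=; apply/negPn/negP => /=; rewrite -lt0n => /card_gt0P[a].
rewrite inE => /andP[xa ba].
have [u uP ua] : exists2 u, e x u && e y u & u != a.
  move: cxy => /card_gt1P[u [v []]]; rewrite !inE => uP vP uv.
  have [ua|] := eqVneq u a; last by exists u.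
  by exists v => //; rewrite -ua eq_sym.
case/andP: uP => xu yu.
apply: (@C5f x a b y u); rewrite // 1?eq_sym //.
- by apply: contraNneq nxy => E; move: xa; rewrite E.
- by apply: contraNneq nxb => E; move: xu; rewrite E.
- by rewrite e_sym.
- by rewrite e_sym.
- by rewrite e_sym.
Qed.

(** Sending [y] to a common neighbour of [x] and [y] is injective. If [y] and [y'] have the same
    image [u], the 4-cycle [y u y' b] has the chord [y y'], since the chord [u b] would give the
    null pair a common neighbour. A second common neighbour [v] of [x] and [y] then yields the
    5-cycle [u x v y y']. *)
Lemma double_null_count x b : null x b ->
  #|[set y | double x y && e y b]| <= degree x.
Proof.
move=> /and3P[xb nxb c0].
have cN u : e x u -> e b u -> False.
  move=> xu bu; move: c0; rewrite cards_eq0 => /eqP/setP/(_ u).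
  by rewrite !inE xu bu.
pose f y := odflt y [pick u | e x u && e y u].
have fP y : double x y -> e x (f y) && e y (f y).
  move=> /and3P[_ _ cxy]; rewrite /f; case: pickP => //= H.
  have /card_gt0P[u] : 0 < codegree x y by lia.
  by rewrite inE H.
rewrite -(@card_in_imset _ _ f).
  apply: subset_leq_card; apply/subsetP => u /imsetP[y].
  by rewrite inE => /andP[/fP/andP[+ _] _] ->.
move=> y y'; rewrite !inE => /andP[dxy yb] /andP[dxy' y'b] fE; apply/eqP.
apply/negPn/negP => yy'.
have /andP[xu yu] := fP _ dxy; have /andP[_ y'u] := fP _ dxy'.
rewrite -fE in y'u; set u := f y in fE xu yu y'u.
have ub : u != b by apply: contraNneq nxb => <-.
have eyy' : e y y'.
  have := C4f yy' ub yu; rewrite e_sym y'u y'b e_sym yb => /(_ isT isT isT)/orP[//|eub].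
  by case: (cN u) => //; rewrite e_sym.
case/and3P: (dxy) => xy nxy cxy; case/and3P: dxy' => xy' nxy' _.
have [v /andP[xv yv] vu] : exists2 v, e x v && e y v & v != u.
  move: cxy => /card_gt1P[v [w []]]; rewrite !inE => vP wP vw.
  have [vu|] := eqVneq v u; last by exists v.
  by exists w => //; rewrite -vu eq_sym.
have vy' : v != y' by apply: contraNneq nxy' => <-.
apply: (@C5f u x v y y'); rewrite // 1?eq_sym //; first [exact: e_neq|by rewrite e_sym].
Qed.

(** Double counting of the adjacent pairs [y], [b] with [y] double and [b] null for [x]: at most two
    neighbours of [y] are adjacent to [x], and all others are null by [double_null]. *)
Lemma sum_double x :
  \sum_(y | double x y) (degree y - 2) <= #|null x| * degree x.
Proof.
apply: (@leq_trans (\sum_(y | double x y) #|[set b | null x b && e y b]|)).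
  apply: leq_sum => y dxy; have /and3P[xy nxy _] := dxy.
  rewrite leq_subLR /degree -(cardID (e x) (e y)).
  apply: leq_add.
    apply: leq_trans (codegree_le2 xy nxy); apply: subset_leq_card.
    by apply/subsetP => z; rewrite !inE andbC.
  apply: subset_leq_card; apply/subsetP => z; rewrite !inE /= => /andP[nxz yz].
  by rewrite (double_null dxy) //= yz.
under eq_bigr do rewrite -sum1dep_card.
rewrite (exchange_big_dep (null x)) /=; last by move=> y b _ /andP[].
rewrite -sum_nat_const; apply: leq_sum => b nxb.
apply: leq_trans (double_null_count nxb); rewrite -sum1dep_card.
by rewrite (eq_bigl (fun y => double x y && e y b)) // => y; rewrite nxb.
Qed.

End Upper.

(** * Counting paths of length two *)

Section Counting.
Variables (T : finType) (e : rel T) (D : nat).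
Hypotheses (e_sym : symmetric e) (e_irr : irreflexive e).
Hypotheses (C5f : C5_free e) (C4f : induced_C4_free e).
Hypothesis (D0 : 0 < D).
Hypothesis deg_ge : forall x y, e x y -> D <= #|e x|.
Local Notation n := #|T|.
Local Notation deg := (degree e).
Local Open Scope ring_scope.

Local Notation ndouble x := (#|double e x|%:R : rat).
Local Notation nnull x := (#|null e x|%:R : rat).

Lemma double_deg x y : double e x y -> (D <= deg x)%N /\ (D <= deg y)%N.
Proof.
case/and3P => _ _ c; have /card_gt0P[z] : (0 < codegree e x y)%N by apply: ltnW.
by rewrite inE => /andP[/deg_ge ? /deg_ge ?].
Qed.

(** Exchanging [x] and [y] shows that twice the right-hand side is a sum of terms [t + 1/t >= 2],
    with [t] the ratio of the two degrees. *)
Lemma sum_ndouble_ratio :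
  \sum_x ndouble x <= \sum_x \sum_(y | double e x y) (deg y)%:R / (deg x)%:R.
Proof.
have H : \sum_x \sum_(y | double e x y) (deg y)%:R / (deg x)%:R =
    \sum_x \sum_(y | double e x y) (deg x)%:R / (deg y)%:R :> rat.
  rewrite (exchange_big_dep xpredT) //=; apply: eq_bigr => x _; apply: eq_bigl => y.
  by rewrite double_sym.
suff : \sum_x ndouble x *+ 2 <=
   \sum_x \sum_(y | double e x y) ((deg y)%:R / (deg x)%:R + (deg x)%:R / (deg y)%:R) :> rat.
  have -> : \sum_x \sum_(y | double e x y) ((deg y)%:R / (deg x)%:R + (deg x)%:R / (deg y)%:R) =
      \sum_x \sum_(y | double e x y) (deg y)%:R / (deg x)%:R +
      \sum_x \sum_(y | double e x y) (deg x)%:R / (deg y)%:R :> rat.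
    by rewrite -big_split; apply: eq_bigr => x _; rewrite -big_split.
  by rewrite -H sumrMnl; lra.
apply: ler_sum => x _; have -> : ndouble x *+ 2 = \sum_(y | double e x y) 2.
  by rewrite sumr_const -[RHS]mulr_natr -[LHS]mulr_natl.
apply: ler_sum => y dxy; have [dx dy] := double_deg dxy.
have x0 : 0 < (deg x)%:R :> rat by rewrite ltr0n; lia.
have y0 : 0 < (deg y)%:R :> rat by rewrite ltr0n; lia.
rewrite addf_div ?gt_eqF // ler_pdivlMr ?mulr_gt0 //.
have := sqr_ge0 ((deg x)%:R - (deg y)%:R : rat); rewrite expr2; lra.
Qed.

(** This is [sum_double] divided by [deg x]; each subtracted 2 costs at most [2 / deg x <= 2 / D],
    over at most [n ^ 2] ordered pairs. *)
Lemma sum_ndouble_le :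
  \sum_x ndouble x <= \sum_x nnull x + 2 / D%:R * n%:R ^+ 2.
Proof.
apply: le_trans sum_ndouble_ratio _.
have -> : 2 / D%:R * n%:R ^+ 2 = \sum_(x : T) \sum_(y : T) (2 / D%:R) :> rat.
  by rewrite !sumr_const -mulrnA -[RHS]mulr_natr natrM expr2.
rewrite -big_split; apply: ler_sum => x _ /=.
have [d0|x0] := posnP #|double e x|.
  rewrite big_pred0 ?addr_ge0 ?sumr_ge0 // => [y _|y]; first by rewrite divr_ge0.
  by have := card0_eq d0 y.
have /card_gt0P[y0 /double_deg[Dx _]] := x0.
have dx0 : 0 < (deg x)%:R :> rat by rewrite ltr0n; lia.
have DR : 0 < D%:R :> rat by rewrite ltr0n.
rewrite -mulr_suml ler_pdivrMr // mulrDl.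
have S := sum_double e_sym e_irr C5f C4f x.
have S' : \sum_(y | double e x y) ((deg y)%:R - 2) <= nnull x * (deg x)%:R :> rat.
  move: S; rewrite -(ler_nat rat) natrM natr_sum; apply: le_trans.
  apply: ler_sum => y _.
  by rewrite lerBlDr -natrD ler_nat; lia.
rewrite sumrB in S'.
suff : \sum_(y | double e x y) 2 <= (\sum_(y in T) 2 / D%:R) * (deg x)%:R :> rat by lra.
rewrite mulr_suml [X in X <= _]big_mkcond; apply: ler_sum => y _.
have : 2 <= 2 / D%:R * (deg x)%:R :> rat.
  by rewrite mulrAC ler_pdivlMr // ler_pM2l // ler_nat.
by case: ifP => // _; lra.
Qed.

Lemma sum_codegree : (\sum_x \sum_y codegree e x y = \sum_u deg u ^ 2)%N.
Proof.
transitivity (\sum_x \sum_y \sum_(u | e x u && e y u) 1)%N.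
  by apply: eq_bigr => x _; apply: eq_bigr => y _; rewrite sum1dep_card.
under eq_bigr do rewrite (exchange_big_dep xpredT) //=.
rewrite exchange_big /=; apply: eq_bigr => u _.
transitivity (\sum_(x | e u x) \sum_(y | e u y) 1)%N; last first.
  by rewrite sum_nat_const sum1_card -mulnn.
rewrite [RHS]big_mkcond; apply: eq_bigr => x _; rewrite (e_sym x u).
by case: (e u x); [apply: eq_bigl => y; rewrite e_sym|rewrite big_pred0].
Qed.

(* The neighbourhood of [u] contains no path on four vertices. *)
Lemma triangle_count u :
  (\sum_(x | e u x) #|[set y | e u y && e x y]| <= 3 * deg u)%N.
Proof.
pose d x := #|[set y | e u y && e x y]|.
rewrite (bigID (fun x => d x <= 2)%N) /= (_ : (3 = 2 + 1)%N) // mulnDl mul1n.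
apply: leq_add.
  rewrite mulnC -sum_nat_const [X in (_ <= X)%N]big_mkcond /= big_mkcond.
  apply: leq_sum => x _; rewrite -topredE /=.
  by case: (e u x) => //=; case: ifP.
(* It remains to treat the [x] with [d x >= 3]. Each [y] is adjacent to at most one of them: two
   such, [x] and [x'], and a further neighbour [w] of [x] would close the 5-cycle [u w x y x']. *)
under eq_bigr do rewrite -sum1dep_card.
rewrite (exchange_big_dep (e u)) /=; last by move=> x y _ /andP[].
rewrite /degree -sum1_card; apply: leq_sum => y uy.
rewrite sum1dep_card leqNgt; apply/negP => /card_gt1P[x [x' []]].
rewrite !inE uy /= => /andP[/andP[ux dx] xy] /andP[/andP[ux' _] x'y] xx'.
have [w] : exists w, w \in [set z | e u z && e x z] :\ y :\ x'.
  apply/set0Pn; rewrite -card_gt0.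
  have := cardsD1 x' ([set z | e u z && e x z] :\ y).
  have := cardsD1 y [set z | e u z && e x z]; rewrite -/(d x).
  by case: (_ \in _); case: (_ \in _); lia.
rewrite !inE => /and3P[wx' wy /andP[uw xw]].
apply: (@C5f u w x y x'); rewrite ?(e_neq e_irr ux) ?(e_neq e_irr uy) // e_sym //.
Qed.

(** Paths are counted by their ordered pair of ends. Once null pairs are balanced against double
    ones, non-adjacent pairs account for about one path each; the diagonal adds the degree sum and
    adjacent pairs at most three times it, whence the factor 4. *)
Lemma sum_degree_sq : (\sum_x (deg x)%:R ^+ 2 <=
  n%:R ^+ 2 * (1 + 2 / D%:R) + 4 * \sum_x (deg x)%:R :> rat).
Proof.
have T3 : (\sum_x \sum_(y | e x y) codegree e x y <= 3 * \sum_u deg u)%N.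
  rewrite big_distrr /=.
  apply: leq_trans (leq_sum _ (fun u _ => triangle_count u)); apply: eq_leq.
  transitivity (\sum_x \sum_u \sum_(y | [&& e u x, e u y & e x y]) 1)%N.
    apply: eq_bigr => x _.
    transitivity (\sum_(y | e x y) \sum_(u | e x u && e y u) 1)%N.
      by apply: eq_bigr => y _; rewrite sum1dep_card.
    rewrite (exchange_big_dep xpredT) //=; apply: eq_bigr => u _.
    apply: eq_bigl => y; rewrite (e_sym u x) (e_sym u y).
    by case: (e x u); rewrite ?andbF //= andbC.
  rewrite exchange_big /=; apply: eq_bigr => u _; rewrite [RHS]big_mkcond.
  apply: eq_bigr => x _; case: (e u x) => /=; first by rewrite sum1dep_card.
  by rewrite big_pred0.
have P x y : (codegree e x y + null e x y <=
    1 + double e x y + ((if y == x then deg x else 0) +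
      (if e x y then codegree e x y else 0)))%N.
  rewrite /null /double; have [->|xy] := eqVneq x y.
    have : (codegree e y y <= deg y)%N.
      by apply: subset_leq_card; apply/subsetP => z; rewrite !inE => /andP[].
    by rewrite /=; lia.
  have [exy|nxy] := boolP (e x y) => /=; first by lia.
  have := codegree_le2 e_sym e_irr C5f C4f xy nxy.
  by case: (codegree e x y) => [|[|[|k]]] //=; lia.
have S : (\sum_x \sum_y codegree e x y + \sum_x #|null e x| <=
    n ^ 2 + \sum_x #|double e x| + 4 * \sum_u deg u)%N.
  have C (r : rel T) : (\sum_x #|r x| = \sum_x \sum_y r x y)%N.
    by apply: eq_bigr => x _; rewrite -sum1_card big_mkcond; apply: eq_bigr => y _; rewrite -topredE /=; case: (r x y).
  rewrite (C (null e)) (C (double e)) -big_split /= (_ : (n ^ 2 = \sum_(x : T) \sum_(y : T) 1)%N); last first.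
    by rewrite !sum_nat_const -mulnn muln1.
  rewrite (_ : (4 * \sum_u deg u = \sum_u deg u + 3 * \sum_u deg u)%N); last by lia.
  rewrite addnA; apply: leq_trans (leq_add (leqnn _) T3).
  rewrite -!big_split /=; apply: leq_sum => x _.
  have -> : deg x = (\sum_y (if y == x then deg x else 0))%N by rewrite -big_mkcond big_pred1_eq.
  rewrite [in X in (_ <= X)%N](big_mkcond (e x)) -!big_split /=.
  by apply: leq_sum => y _; rewrite -addnA; apply: P.
have -> : \sum_x (deg x)%:R ^+ 2 = (\sum_x \sum_y codegree e x y)%:R :> rat.
  by rewrite sum_codegree natr_sum; apply: eq_bigr => x _; rewrite natrX.
move: S sum_ndouble_le; rewrite -(ler_nat rat) !natrD natrX -!natr_sum; lra.
Qed.

End Counting.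

(** * From the second moment of the degrees to the number of edges *)

Section UpperBound.
Variables (T : finType).
Implicit Types (e : rel T) (W : {set T}).

(** Cauchy-Schwarz applied to [sum_degree_sq], cleared of denominators. *)
Lemma sum_degree_min_degree e D : symmetric e -> irreflexive e ->
  C5_free e -> induced_C4_free e -> 0 < D -> (forall x y, e x y -> D <= degree e x) ->
  D * (\sum_x degree e x) ^ 2 <=
    (D + 2) * #|T| ^ 3 + 4 * D * #|T| * \sum_x degree e x.
Proof.
move=> es ei c5 c4 D0 dD; have := sum_degree_sq es ei c5 c4 D0 dD.
set n := #|T|; set S := \sum_x degree e x.
rewrite -(ler_nat rat).
have [n0|n0] := posnP n.
  have -> : S = 0; last by rewrite exp0n // muln0.
  by rewrite /S big_pred0 // => x; have := card0_eq n0 x.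
rewrite -natr_sum -/S => H.
have nR : (0 < n%:R :> rat)%R by rewrite ltr0n.
have DR : (0 < D%:R :> rat)%R by rewrite ltr0n.
have CS : (S%:R ^+ 2 <= n%:R * \sum_x (degree e x)%:R ^+ 2 :> rat)%R.
  have : (0 <= \sum_x (n%:R * (degree e x)%:R - S%:R) ^+ 2 :> rat)%R.
    by apply: sumr_ge0 => x _; apply: sqr_ge0.
  rewrite (eq_bigr (fun x => n%:R ^+ 2 * (degree e x)%:R ^+ 2 +
     (- (2 * n%:R * S%:R) * (degree e x)%:R + S%:R ^+ 2)))%R; last by move=> x _; ring.
  rewrite !big_split -!mulr_sumr -natr_sum -/S sumr_const -/n /=.
  rewrite -mulr_natr => h.
  rewrite -(ler_pM2l nR); move: h; rewrite !expr2; lra.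
have {H}H := ler_wpM2l (ltW (mulr_gt0 DR nR)) H.
have {CS}CS := ler_wpM2l (ltW DR) CS.
rewrite !(natrD, natrM, natrX).
have E : (D%:R * n%:R * (n%:R ^+ 2 * (1 + 2 / D%:R) + 4 * S%:R) =
  (D%:R + 2) * n%:R ^+ 3 + 4 * D%:R * n%:R * S%:R :> rat)%R.
  by field; rewrite gt_eqF.
rewrite E in H; lra.
Qed.

(** Deleted vertices remain as isolated points, so the vertex type does not change; accordingly the
    minimum degree condition concerns only ends of edges. *)
Definition restrict e W : rel T := fun x y => [&& e x y, x \in W & y \in W].

Lemma restrict_sym e W : symmetric e -> symmetric (restrict e W).
Proof. by move=> es x y; rewrite /restrict es [(x \in W) && _]andbC. Qed.

(** One extremal choice replaces iterated deletion: [W] maximises the degree sum inside it plus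
    [2 * D] per deleted vertex. Deleting one more vertex lowers the degree sum by twice its degree,
    so this degree is at least [D]; comparison with the full vertex set bounds the loss. *)
Lemma exists_min_degree e D : symmetric e -> irreflexive e ->
  exists W, (forall x y, restrict e W x y -> D <= degree (restrict e W) x) /\
    \sum_x degree e x <= \sum_x degree (restrict e W) x + 2 * D * #|T|.
Proof.
move=> es ei.
pose E W := \sum_x degree (restrict e W) x.
pose W := [arg max_(W > [set: T]) (E W + 2 * D * #|~: W|)].
have WP V : E V + 2 * D * #|~: V| <= E W + 2 * D * #|~: W|.
  by rewrite /W; case: arg_maxnP => // W' _ /(_ V isT).
exists W; split=> [x y /and3P[_ xW _]|].
  have := WP (W :\ x).
  have -> : #|~: (W :\ x)| = #|~: W|.+1.
    have := cardsC W; have := cardsC (W :\ x); have := cardsD1 x W; rewrite xW; lia.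
  suff -> : E W = E (W :\ x) + 2 * degree (restrict e W) x by nia.
  have dE V z : degree (restrict e V) z = \sum_y restrict e V z y.
    by rewrite /degree -sum1_card big_mkcond; apply: eq_bigr => w _; rewrite -topredE /=; case: restrict.
  rewrite mul2n -addnn [in X in _ = _ + (X + _)]dE /E.
  have -> : degree (restrict e W) x = \sum_z \sum_w (if z == x then nat_of_bool (restrict e W z w) else 0).
    by rewrite dE [RHS](bigD1 x) //= eqxx [X in _ = _ + X]big1 ?addn0 // => z /negbTE ->; rewrite big1.
  have -> : \sum_w restrict e W x w = \sum_z \sum_w (if w == x then nat_of_bool (restrict e W z w) else 0).
    apply: eq_bigr => z _; rewrite [RHS](bigD1 x) //= eqxx [X in _ = _ + X]big1 ?addn0.
      by rewrite restrict_sym.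
    by move=> w /negbTE ->.
  rewrite -!big_split /=; apply: eq_bigr => z _; rewrite !dE -!big_split /=.
  apply: eq_bigr => w _; rewrite /restrict !in_setD1.
  have [->|zx] := eqVneq z x; have [->|wx] := eqVneq w x; rewrite /= ?ei ?andbF //= ?addn0 //.
have := WP setT; rewrite setCT cards0 muln0 addn0 => H.
have -> : \sum_x degree e x = E setT.
  by apply: eq_bigr => x _; apply: eq_card => y; rewrite -!topredE /= /restrict !inE !andbT.
apply: leq_trans H _; rewrite leq_add2l leq_mul2l; apply/orP; right.
exact: max_card.
Qed.

Lemma sum_degree_bound e D : symmetric e -> irreflexive e ->
  C5_free e -> induced_C4_free e -> 0 < D ->
  exists2 S, \sum_x degree e x <= S + 2 * D * #|T| &
    D * S ^ 2 <= (D + 2) * #|T| ^ 3 + 4 * D * #|T| * S.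
Proof.
move=> es ei c5 c4 D0; have [W [dW SW]] := exists_min_degree D es ei.
exists (\sum_x degree (restrict e W) x) => //.
apply: sum_degree_min_degree => //.
- exact: restrict_sym.
- by move=> x; rewrite /restrict ei.
- move=> a b c d f ac ad bd bf cf /andP[? _] /andP[? _] /andP[? _] /andP[? _] /andP[? _].
  exact: (c5 a b c d f).
- move=> a b c d ac bd /and3P[ab aW bW] /and3P[bc _ cW] /and3P[cd _ dW'] /and3P[da _ _].
  by rewrite /restrict aW bW cW dW' !andbT; apply: (c4 a b c d).
Qed.

End UpperBound.

(** * Adjacency and degrees in graphs given by edge sets *)

Section Graphs.
Variables (V : finType) (G : sgraph V).

Lemma adj_sym : symmetric (adj G).
Proof. by move=> x y; rewrite /adj setUC. Qed.

Lemma adj_irr : irreflexive (adj G).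
Proof.
move=> x; apply/negP; rewrite /adj setUid => xG.
by have /forall_inP/(_ _ xG) := edges_card2 G; rewrite cards1.
Qed.

Lemma handshake : \sum_x degree (adj G) x = 2 * #|edges G|.
Proof.
transitivity (\sum_x \sum_(E in edges G | x \in E) 1).
  apply: eq_bigr => x _; rewrite sum1dep_card /degree.
  rewrite -(@card_in_imset _ _ (fun y => [set x; y])); last first.
    move=> y z xy xz /setP/(_ y); rewrite !inE eqxx orbT => /esym/orP[/eqP yx|/eqP //].
    by move: xy; rewrite -topredE /= yx adj_irr.
  apply: eq_card => E; rewrite !inE; apply/imsetP/andP => [[y xy ->]|[EG xE]].
    by split; [exact: xy|rewrite set21].
  have /forall_inP/(_ _ EG)/cards2P[a [b [ab EE]]] := edges_card2 G.
  move: xE; rewrite EE !inE => /orP[/eqP xa|/eqP xb].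
    by exists b; rewrite xa // -topredE /= /adj -EE.
  exists a; last by rewrite xb setUC.
  by rewrite xb -topredE /= /adj setUC -EE.
rewrite (exchange_big_dep (mem (edges G))) /=; last by move=> x E _ /andP[].
rewrite mulnC -sum_nat_const; apply: eq_bigr => E EG.
have /forall_inP/(_ _ EG)/eqP := edges_card2 G.
by rewrite -sum1_card => <-; apply: eq_bigl => x; rewrite EG.
Qed.
End Graphs.

(** * The extremal function and the twin construction *)

Section GraphOfRel.
Variables (V : finType) (r : rel V).
Hypotheses (r_sym : symmetric r) (r_irr : irreflexive r).

Lemma set2_inj (a b c d : V) : [set a; b] = [set c; d] ->
  (a = c /\ b = d) \/ (a = d /\ b = c).
Proof.
move=> E.
have := set21 a b; rewrite E !inE => /orP[]/eqP ac; have := set22 a b; rewrite E !inE => /orP[]/eqP bd.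
- left; split=> //; have := set22 c d; rewrite -E !inE ac bd => /orP[]/eqP.
    by [].
  by [].
- by left.
- by right.
- right; split=> //; have := set21 c d; rewrite -E !inE ac bd => /orP[]/eqP; by [].
Qed.

Lemma adj_graph_of_rel x y : adj (graph_of_rel r) x y = r x y.
Proof.
apply/imset2P/idP => [[a b _]|rxy].
  by rewrite inE => /andP[_ /andP[_ rab]] /set2_inj[[-> ->]|[-> ->]] //; rewrite r_sym.
exists x y => //; rewrite inE rxy andbT /=.
by apply: contraTneq rxy => ->; rewrite r_irr.
Qed.
End GraphOfRel.

(** * Forbidden subgraphs as conditions on the adjacency relation *)

Lemma C5_adj (i j : 'I_5) : adj (cycle_graph 5) i j = (j == ordS i) || (i == ordS j).
Proof.
apply/imset2P/idP => [[a b _]|].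
  rewrite inE => /andP[_ /andP[_ /eqP ba]] /set2_inj[[-> ->]|[-> ->]]; rewrite ba eqxx ?orbT //.
have ne (k : 'I_5) : k != ordS k by case: k => [[|[|[|[|[|]]]]]].
case/orP => /eqP->; first by exists i (ordS i); rewrite // inE ne eqxx.
by exists j (ordS j); rewrite ?inE ?ne ?eqxx // setUC.
Qed.

Lemma not_has_C5 (V : finType) (G : sgraph V) :
  ~~ has_copy (cycle_graph 5) G <-> C5_free (adj G).
Proof.
split=> [/existsP H a b c d f ac ad bd bf cf ab bc cd df fa|H].
  apply: H; pose g := [ffun i : 'I_5 => nth a [:: a; b; c; d; f] i]; exists g.
  have ne := @e_neq _ _ (adj_irr G).
  have u : uniq [:: a; b; c; d; f].
    rewrite /= !inE !negb_or ac ad bd bf cf (ne _ _ ab) (ne _ _ bc) (ne _ _ cd) (ne _ _ df) /=.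
    by rewrite eq_sym (ne _ _ fa).
  apply/andP; split.
    apply/injectiveP => i j; rewrite !ffunE => /eqP; rewrite nth_uniq // => /eqP.
    exact: val_inj.
  apply/'forall_'forall_implyP => i j; rewrite C5_adj !ffunE.
  case: i => [[|[|[|[|[|//]]]]] ?]; case: j => [[|[|[|[|[|//]]]]] ?] //= _; rewrite // adj_sym //.
apply/existsP => -[g /andP[/injectiveP gi /'forall_'forall_implyP ga]].
have A (i j : 'I_5) : (j == ordS i) -> adj G (g i) (g j) by move=> ij; apply: ga; rewrite C5_adj ij.
pose o k (H : k < 5) : 'I_5 := Ordinal H.
apply: (H (g (@o 0 isT)) (g (@o 1 isT)) (g (@o 2 isT)) (g (@o 3 isT)) (g (@o 4 isT)));
  by [rewrite (inj_eq gi)|apply: A].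
Qed.

Lemma K22_adj u v : adj (complete_bipartite 2 2) u v =
  match u, v with inl _, inr _ | inr _, inl _ => true | _, _ => false end.
Proof.
apply/imset2P/idP => [[a b _]|].
  rewrite inE => /andP[_ /andP[_ ab]] /set2_inj[[-> ->]|[-> ->]]; by case: a b ab => a [].
case: u v => u [] v // _; first by exists (inl u) (inr v); rewrite ?inE.
by exists (inl v) (inr u); rewrite ?inE // setUC.
Qed.

Lemma not_has_induced_K22 (V : finType) (G : sgraph V) :
  ~~ has_induced_copy (complete_bipartite 2 2) G <-> induced_C4_free (adj G).
Proof.
split=> [/existsP H a b c d ac bd ab bc cd da|H].
  rewrite -implyNb; apply/implyP => nac; apply/negPn/negP => nbd.
  apply: H; pose g : {ffun 'I_2 + 'I_2 -> V} := [ffun u => match u with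
    | inl i => if val i == 0 then a else c | inr i => if val i == 0 then b else d end].
  exists g; have ne := @e_neq _ _ (adj_irr G).
  have sy := adj_sym G; have ir := adj_irr G.
  have [[[nab nbc] ncd] nda] := (ne _ _ ab, ne _ _ bc, ne _ _ cd, ne _ _ da).
  apply/andP; split.
    apply/injectiveP => u v; rewrite !ffunE.
    case: u => [] [[|[|//]] ?]; case: v => [] [[|[|//]] ?] //= E;
      try (by congr inl; apply: val_inj); try (by congr inr; apply: val_inj);
      by move: nab nbc ncd nda ac bd; rewrite E ?eqxx.
  apply/forallP => u; apply/forallP => v; apply/eqP; rewrite K22_adj !ffunE.
  case: u => [] [[|[|//]] ?]; case: v => [] [[|[|//]] ?] /=; rewrite ?ir //; apply/esym;
   first [done | by rewrite sy | by apply/negbTE | by apply/negbTE; rewrite sy].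
apply/existsP => -[g /andP[/injectiveP gi /forallP ga]].
have A u v : adj G (g u) (g v) = adj (complete_bipartite 2 2) u v.
  by have /forallP/(_ v)/eqP := ga u.
pose o k (H : k < 2) : 'I_2 := Ordinal H.
have := H (g (inl (@o 0 isT))) (g (inr (@o 0 isT))) (g (inl (@o 1 isT))) (g (inr (@o 1 isT))).
by rewrite !A !K22_adj !(inj_eq gi) /= => /(_ isT isT isT isT isT isT).
Qed.

Lemma le_ex_ind n (G : sgraph 'I_n) : C5_free (adj G) -> induced_C4_free (adj G) ->
  #|edges G| <= ex_ind n (cycle_graph 5) (complete_bipartite 2 2).
Proof.
move=> c5 c4; rewrite /ex_ind; apply: (@leq_bigmax_cond _ _ (fun G => #|edges G|)).
by apply/andP; split; [apply/not_has_C5|apply/not_has_induced_K22].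
Qed.

Definition free_graph n (G : sgraph 'I_n) :=
  ~~ has_copy (cycle_graph 5) G && ~~ has_induced_copy (complete_bipartite 2 2) G.

(** The edgeless graph qualifies; hence the maximum in [ex_ind] is attained. *)
Lemma free_graph_exists n : 0 < #|@free_graph n|.
Proof.
apply/card_gt0P; exists (graph_of_rel (fun _ _ => false)).
have A x y : adj (graph_of_rel (fun _ _ : 'I_n => false)) x y = false.
  by rewrite adj_graph_of_rel.
rewrite -topredE /=; apply/andP; split; [apply/not_has_C5|apply/not_has_induced_K22].
  by move=> a b c d f _ _ _ _ _; rewrite A.
by move=> a b c d _ _; rewrite A.
Qed.

(** Here [S] is the degree sum of an extremal graph after the deletion of vertices of low degree. *)
Lemma ex_ind_upper n D : 0 < D ->
  exists2 S, 2 * ex_ind n (cycle_graph 5) (complete_bipartite 2 2) <= S + 2 * D * n &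
    D * S ^ 2 <= (D + 2) * n ^ 3 + 4 * D * n * S.
Proof.
move=> D0; set ex := ex_ind _ _ _.
have [G [c5 c4 GE]] : exists G : sgraph 'I_n,
  [/\ C5_free (adj G), induced_C4_free (adj G) & #|edges G| = ex].
  have [G /andP[/not_has_C5 c5 /not_has_induced_K22 c4] GE] := eq_bigmax_cond
    (fun G : sgraph 'I_n => #|edges G|) (free_graph_exists n).
  by exists G; split=> //; rewrite /ex /ex_ind (eq_bigl _ _ (fun=> erefl)) GE.
have [S S1 S2] := sum_degree_bound (adj_sym G) (adj_irr G) c5 c4 D0.
rewrite card_ord in S1 S2; exists S => //; rewrite -GE -handshake //.
Qed.

(* Every vertex on the side [L] of a C4-free bipartite graph is doubled into two
   adjacent twins. *)
Section TwinGraph.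
Variables (P L : finType) (I : P -> L -> bool).
Hypothesis I_linear : forall p q l m, I p l -> I p m -> I q l -> I q m -> p = q \/ l = m.

Definition twin_rel : rel (P + L * bool) := fun u v =>
  match u, v with
  | inl p, inr (l, _) | inr (l, _), inl p => I p l
  | inr (l, i), inr (m, j) => (l == m) && (i != j)
  | inl _, inl _ => false
  end.

Lemma twin_rel_sym : symmetric twin_rel.
Proof. by case=> [p|[l i]] [q|[m j]] //=; rewrite eq_sym [j == i]eq_sym. Qed.

Lemma twin_rel_irr : irreflexive twin_rel.
Proof. by case=> [p|[l i]] //=; rewrite !eqxx. Qed.

Ltac twin_cases :=
  repeat match goal with
  | H : is_true ((_ == _) && _) |- _ => move/andP: H => [/eqP ? H]; subst
  end;
  try match goal with
  | H1 : is_true (I ?p ?l), H2 : is_true (I ?p ?m),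
    H3 : is_true (I ?q ?l), H4 : is_true (I ?q ?m) |- _ =>
      tryif constr_eq p q then fail else tryif constr_eq l m then fail else
      (have [?|?] := I_linear H1 H2 H3 H4; subst)
  end;
  repeat match goal with b : ?T |- _ => unify T bool; destruct b end; try discriminate;
  try congruence; rewrite ?eqxx ?orbT //.

(** Points are adjacent only to lines and a line has only two copies, so a 4-cycle alternates
    between the sides. By linearity its two line vertices are copies of one line, hence adjacent. *)
Lemma twin_rel_C4 : induced_C4_free twin_rel.
Proof.
move=> [a|[a i]] [b|[b j]] [c|[c k]] [d|[d l]] /eqP ac /eqP bd //= ab bc cd da; twin_cases.
Qed.

(** A cycle has an even number of point-line edges and no two consecutive twin edges, so a 5-cycle
    has exactly one twin edge. Its other vertices are two points and a line vertex, which by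
    linearity would be a third copy of the same line. *)
Lemma twin_rel_C5 : C5_free twin_rel.
Proof.
by move=> [a|[a i]] [b|[b j]] [c|[c k]] [d|[d l]] [f|[f m]]
  /eqP ac /eqP ad /eqP bd /eqP bf /eqP cf //= ab bc cd df fa; twin_cases.
Qed.

End TwinGraph.

(** * The twin graph inside ['I_n] *)

Section TwinCount.
Variables (P L K : finType) (I : P -> L -> bool) (h : K -> P * L) (n : nat).
Hypothesis I_linear : forall p q l m, I p l -> I p m -> I q l -> I q m -> p = q \/ l = m.
Hypotheses (h_inj : injective h) (h_inc : forall k, I (h k).1 (h k).2).
Hypothesis le_n : #|P| + 2 * #|L| <= n.
Local Notation T := (P + L * bool)%type.

Lemma card_twin : #|{: T}| <= n.
Proof. by rewrite card_sum card_prod card_bool mulnC. Qed.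

Definition twin_emb (u : T) : 'I_n := widen_ord card_twin (enum_rank u).

Lemma twin_emb_inj : injective twin_emb.
Proof. by move=> u v /(congr1 val) /= /val_inj/enum_rank_inj. Qed.

(** The partial inverse of [twin_emb]; surplus vertices get [None] and are isolated in
    [twin_ord]. *)
Definition twin_proj (i : 'I_n) : option T := [pick u | twin_emb u == i].

Lemma twin_embK u : twin_proj (twin_emb u) = Some u.
Proof.
rewrite /twin_proj; case: pickP => [v /eqP/twin_emb_inj->//|/(_ u)].
by rewrite eqxx.
Qed.

Lemma twin_projK i u : twin_proj i = Some u -> twin_emb u = i.
Proof. by rewrite /twin_proj; case: pickP => // v /eqP <- [->]. Qed.

Definition twin_ord : rel 'I_n := fun i j =>
  if (twin_proj i, twin_proj j) is (Some u, Some v) then twin_rel I u v else false.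

Lemma twin_ord_sym : symmetric twin_ord.
Proof.
by move=> i j; rewrite /twin_ord; case: (twin_proj i) (twin_proj j) => [u|] [v|] //; rewrite twin_rel_sym.
Qed.

Lemma twin_ord_irr : irreflexive twin_ord.
Proof. by move=> i; rewrite /twin_ord; case: (twin_proj i) => // u; rewrite twin_rel_irr. Qed.

Lemma twin_proj_neq i j u v : twin_proj i = Some u -> twin_proj j = Some v -> i != j -> u != v.
Proof. by move=> /twin_projK <- /twin_projK <-; apply: contraNneq => ->. Qed.

Lemma twin_ord_C5 : C5_free twin_ord.
Proof.
move=> a b c d f ac ad bd bf cf; rewrite /twin_ord.
case Ea: (twin_proj a) => [a'|] //; case Eb: (twin_proj b) => [b'|] //.
case Ec: (twin_proj c) => [c'|] //; case Ed: (twin_proj d) => [d'|] //.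
case Ef: (twin_proj f) => [f'|] //.
by apply: (twin_rel_C5 I_linear); [apply: twin_proj_neq Ea Ec _|apply: twin_proj_neq Ea Ed _
  |apply: twin_proj_neq Eb Ed _|apply: twin_proj_neq Eb Ef _|apply: twin_proj_neq Ec Ef _].
Qed.

Lemma twin_ord_C4 : induced_C4_free twin_ord.
Proof.
move=> a b c d ac bd; rewrite /twin_ord.
case Ea: (twin_proj a) => [a'|] //; case Eb: (twin_proj b) => [b'|] //.
case Ec: (twin_proj c) => [c'|] //; case Ed: (twin_proj d) => [d'|] //.
by apply: (twin_rel_C4 I_linear); [apply: twin_proj_neq Ea Ec _|apply: twin_proj_neq Eb Ed _].
Qed.

(** Each incidence, indexed by [K], contributes one edge to either twin of its line. *)
Lemma twin_le_ex_ind : 2 * #|K| <= ex_ind n (cycle_graph 5) (complete_bipartite 2 2).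
Proof.
have A := adj_graph_of_rel twin_ord_sym twin_ord_irr.
pose G := graph_of_rel twin_ord.
have := @le_ex_ind n G; set ex := ex_ind _ _ _ => /(_ _ _) H.
apply: leq_trans (H _ _).
- pose g (x : K * bool) := [set twin_emb (inl (h x.1).1); twin_emb (inr ((h x.1).2, x.2))].
  have gi : injective g.
    move=> [k i] [k' i'] /set2_inj[[/twin_emb_inj[E1] /twin_emb_inj[E2 ->]]|[/twin_emb_inj //]].
    congr (_, _); apply: h_inj.
    by rewrite (surjective_pairing (h k)) (surjective_pairing (h k')) E1 E2.
  rewrite mulnC -card_bool -card_prod -(card_image gi).
  apply: subset_leq_card; apply/subsetP => _ /imageP[[k i] _ ->] /=.
  rewrite -[_ \in _]/(adj G _ _) A /twin_ord !twin_embK /=; exact: h_inc.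
- by move=> a b c d f ? ? ? ? ?; rewrite !A; apply: twin_ord_C5.
- by move=> a b c d ? ?; rewrite !A; apply: twin_ord_C4.
Qed.

End TwinCount.

(** The points are the pairs [(x, y)], the lines [y = a * x + b] the pairs [(a, b)], and an
    incidence is given freely by [x], [a] and [b]. This makes [p ^ 2 + 2 * p ^ 2] vertices and
    [p ^ 3] incidences. *)
Lemma affine_lower_bound p n : prime p -> 3 * p ^ 2 <= n ->
  2 * p ^ 3 <= ex_ind n (cycle_graph 5) (complete_bipartite 2 2).
Proof.
move=> pp pn.
pose I (x l : 'F_p * 'F_p) := x.2 == (l.1 * x.1 + l.2)%R.
pose h (k : 'F_p * 'F_p * 'F_p) := ((k.1.1, (k.1.2 * k.1.1 + k.2)%R), (k.1.2, k.2)).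
have pE : (p ^ 3 = #|{: 'F_p * 'F_p * 'F_p}|)%N by rewrite !card_prod !card_Fp // !expnS expn0 muln1 mulnA.
rewrite pE; apply: (@twin_le_ex_ind _ _ _ I h).
- move=> [x y] [x' y'] [a b] [a' b'] /eqP /= -> /eqP /= E1 /eqP /= -> /eqP /= E2.
  have : ((a - a') * (x - x') == 0)%R.
    rewrite (_ : _ * _ = (a * x + b) - (a' * x + b') - ((a * x' + b) - (a' * x' + b')))%R; last by ring.
    by rewrite E1 E2 !subrr.
  rewrite mulf_eq0 !subr_eq0 => /orP[/eqP aa|/eqP ->]; last by left.
  by right; rewrite aa in E1 *; rewrite (addrI _ E1).
- by move=> [[x a] b] [[x' a'] b'] [-> _ -> ->].
- by move=> [[x a] b]; rewrite /I.
- by rewrite !card_prod !card_Fp // mulnn; lia.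
Qed.

Import reals sequences exp boolp.
Local Open Scope ring_scope.

(** * Von Mangoldt and Moebius functions *)

Lemma sum_multiples (V : nmodType) (N d : nat) (f : nat -> V) : (0 < d)%N ->
  \sum_(1 <= n < N.+1 | (d %| n)%N) f n =
  \sum_(1 <= m < (N %/ d).+1) f (d * m)%N.
Proof.
move=> d0; elim: N => [|N IH]; first by rewrite div0n !big_nil.
rewrite big_mkcond big_nat_recr //= -big_mkcond /= IH divnS //.
case: ifP => [dN|_]; last by rewrite addr0.
rewrite add1n [RHS]big_nat_recr //=; congr (_ + f _).
by have := divnK dN; rewrite divnS // dN add1n mulnC.
Qed.

Lemma sum_divisors_widen (V : nmodType) (N n : nat) (f : nat -> V) :
  (0 < n <= N)%N ->
  \sum_(1 <= d < n.+1 | (d %| n)%N) f d = \sum_(1 <= d < N.+1 | (d %| n)%N) f d.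
Proof.
move=> /andP[n0 nN]; rewrite [RHS](@big_cat_nat _ _ _ n.+1) //=.
rewrite [X in _ + X]big1_seq ?addr0 // => d; rewrite mem_index_iota.
by move=> /andP[dn /andP[nd _]]; have := dvdn_leq n0 dn; lia.
Qed.

Lemma sum_divisors_exchange (V : nmodType) (N : nat) (f : nat -> nat -> V) :
  \sum_(1 <= n < N.+1) \sum_(1 <= d < n.+1 | (d %| n)%N) f d n =
  \sum_(1 <= d < N.+1) \sum_(1 <= m < (N %/ d).+1) f d (d * m)%N.
Proof.
under eq_big_nat => n nN do rewrite (@sum_divisors_widen _ N) //.
rewrite (exchange_big_dep xpredT) //=.
apply: eq_big_nat => d /andP[d0 _].
by rewrite -sum_multiples.
Qed.

Definition squarefree (n : nat) := all (fun p => logn p n == 1%N) (primes n).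

Section NumberTheory.
Variable R : realType.
Implicit Types (n m d p N M : nat).

Lemma ln_leB1 (x : R) : 0 < x -> ln x <= x - 1.
Proof.
by move=> x0; have := @le_ln1Dx R (x - 1); rewrite addrCA subrr addr0; apply; lra.
Qed.

Lemma ln_subW (x y : R) : 0 < x -> 0 < y -> ln y - ln x <= (y - x) / x.
Proof.
move=> x0 y0; rewrite -ln_div ?posrE //.
apply: le_trans (ln_leB1 _) _; first by rewrite divr_gt0.
by rewrite mulrBl divff // gt_eqF.
Qed.

Lemma lnnat_ge0 n : 0 <= ln (n%:R : R).
Proof.
case: n => [|n]; first by rewrite ln0.
by rewrite ln_ge0 // ler1n.
Qed.

Lemma ler_lnnat m n : (0 < m)%N -> (m <= n)%N -> ln (m%:R : R) <= ln n%:R.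
Proof. by move=> m0 mn; rewrite ler_ln ?posrE ?ltr0n ?ler_nat //; lia. Qed.

(** The list [primes n] is a singleton exactly when [n] is a prime power. *)
Definition mangoldt n : R := if primes n is [:: p] then ln p%:R else 0.

Lemma mangoldt_ge0 n : 0 <= mangoldt n.
Proof. by rewrite /mangoldt; case: (primes n) => [|p []] // *; apply: lnnat_ge0. Qed.

Lemma mangoldt_le_ln n : mangoldt n <= ln n%:R.
Proof.
rewrite /mangoldt; case E: (primes n) => [|p [|q s]] //=; try exact: lnnat_ge0.
have : p \in primes n by rewrite E inE.
rewrite mem_primes => /and3P[pp n0 pn].
by apply: ler_lnnat; [exact: prime_gt0|exact: dvdn_leq].
Qed.

Lemma mangoldt_pexp p k : prime p -> (0 < k)%N -> mangoldt (p ^ k) = ln p%:R.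
Proof. by move=> pp k0; rewrite /mangoldt primesX // primes_prime. Qed.

Lemma mangoldt_neq0 n : mangoldt n != 0 ->
  exists2 p, prime p & exists2 k, (0 < k)%N & n = (p ^ k)%N.
Proof.
rewrite /mangoldt; case E: (primes n) => [|p [|q s]] //=; rewrite ?eqxx // => _.
have pn : p \in primes n by rewrite E inE.
have := pn; rewrite mem_primes => /and3P[pp n0 pdn].
exists p => //; exists (logn p n); first by rewrite logn_gt0.
rewrite [LHS](prod_prime_decomp n0) prime_decompE E /= big_cons big_nil muln1 //.
Qed.

Lemma mangoldt1 : mangoldt 1 = 0. Proof. by []. Qed.

(** Induction through [n = m * p] with [p] prime: the only prime power dividing [n] but not [m] is
    [q], the full power of [p] in [n], and it contributes [ln p]. *)
Lemma sum_mangoldt_divisors n : (0 < n)%N ->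
  \sum_(1 <= d < n.+1 | (d %| n)%N) mangoldt d = ln n%:R.
Proof.
elim/ltn_ind: n => n IH n0.
have [n1|n1] := leqP n 1.
  have -> : n = 1%N by lia.
  by rewrite big_mkcond big_nat1 /= mangoldt1 ln1.
set p := pdiv n; have pp : prime p by rewrite pdiv_prime.
have p1 := prime_gt1 pp.
have [m nE] := dvdnP (pdiv_dvd n); rewrite -/p in nE.
have m0 : (0 < m)%N by rewrite nE muln_gt0 in n0; case/andP: n0.
have mn : (m < n)%N by rewrite nE -{1}[m]muln1 ltn_pmul2l.
have p0 := prime_gt0 pp.
rewrite nE natrM lnM ?posrE ?ltr0n // -(IH m) //.
rewrite (@sum_divisors_widen _ (m * p) m); last by rewrite m0 -nE ltnW.
rewrite (bigID (fun d => d %| m)%N) /=; congr (_ + _).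
  by apply: eq_bigl => d; case: (boolP (d %| m)%N) => [/dvdn_mulr->|]; rewrite ?andbF.
have mp0 : (0 < m * p)%N by rewrite muln_gt0 m0.
have lp : logn p (m * p) = (logn p m).+1.
  by rewrite lognM // (logn_prime p pp) eqxx addn1.
set q := (p ^ (logn p m).+1)%N.
have qP : (q %| m * p)%N && ~~ (q %| m)%N.
  by rewrite !pfactor_dvdn // lp leqnn ltnn.
have qin : q \in index_iota 1 (m * p).+1.
  have /andP[qmp _] := qP; have := dvdn_leq mp0 qmp.
  by rewrite mem_index_iota ltnS expn_gt0 p0.
rewrite big_mkcond (bigD1_seq q) ?iota_uniq //= qP mangoldt_pexp //.
rewrite big1_seq ?addr0 // => d /andP[dq _]; case: ifP => // /andP[dmp dm].
apply/eqP; apply: contraTT dq => /mangoldt_neq0[r rp [k k0 dE]]; rewrite negbK.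
have [rE|rnp] := eqVneq r p.
  move: dmp dm; rewrite dE rE !pfactor_dvdn // lp -ltnNge => k1 k2.
  by rewrite /q; apply/eqP; congr (_ ^ _)%N; lia.
have cop : coprime d p by rewrite dE coprimeXl // prime_coprime // dvdn_prime2.
by move: dmp; rewrite Gauss_dvdl // (negbTE dm).
Qed.

Definition moebius n : R := if squarefree n then (-1) ^+ size (primes n) else 0.

Lemma moebius_le1 n : `|moebius n| <= 1.
Proof. by rewrite /moebius; case: ifP => _; rewrite ?normr_sign // normr0. Qed.

Lemma moebius_mul_prime p d : prime p -> (0 < d)%N ->
  moebius (p * d) = if (p %| d)%N then 0 else - moebius d.
Proof.
move=> pp d0; have p0 := prime_gt0 pp; rewrite /moebius.
case: (boolP (p %| d)%N) => [pd|/negbTE pd].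
  have -> // : squarefree (p * d) = false.
  apply/negP => /allP/(_ p).
  have -> : p \in primes (p * d).
    by rewrite primesM // primes_prime // inE eqxx.
  rewrite lognM // logn_prime // eqxx.
  have : (0 < logn p d)%N by rewrite logn_gt0 mem_primes pp d0.
  by lia.
have pe : perm_eq (primes (p * d)) (p :: primes d).
  apply: uniq_perm; rewrite ?primes_uniq //=.
    by rewrite primes_uniq andbT mem_primes pp d0 pd.
  by move=> q; rewrite primesM // primes_prime // !inE.
have -> : squarefree (p * d) = squarefree d.
  rewrite /squarefree (perm_all _ pe) /= lognM // logn_prime // eqxx.
  have -> : logn p d = 0%N by apply/eqP; rewrite -leqn0 leqNgt logn_gt0 mem_primes pp d0 pd.
  rewrite /=; apply: eq_in_all => q; rewrite mem_primes => /and3P[qp _ qd].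
  rewrite lognM // logn_prime //.
  by have /negbTE -> : q != p by apply: contraFneq pd => <-.
by rewrite (perm_size pe) /= exprS mulN1r; case: ifP; rewrite ?oppr0.
Qed.

(** For a prime [p] dividing [n], the divisors [p * d] with [d] prime to [p] cancel against the
    divisors [d]. *)
Lemma sum_moebius_divisors n : (0 < n)%N ->
  \sum_(1 <= d < n.+1 | (d %| n)%N) moebius d = (n == 1%N)%:R.
Proof.
move=> n0; have [n1|n1] := leqP n 1.
  have -> : n = 1%N by lia.
  by rewrite big_mkcond big_nat1 /= /moebius.
rewrite gtn_eqF //=.
have [p pp [m nE]] : exists2 p, prime p & exists m, n = (p * m)%N.
  exists (pdiv n); first exact: pdiv_prime.
  by have [m] := dvdnP (pdiv_dvd n); rewrite mulnC => mE; exists m.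
have p1 := prime_gt1 pp; have p0 := prime_gt0 pp.
have m0 : (0 < m)%N by rewrite nE muln_gt0 in n0; case/andP: n0.
have mn : (m < n)%N by rewrite nE -{1}[m]mul1n ltn_pmul2r.
rewrite (bigID (fun d => p %| d)%N) /=.
have -> : \sum_(1 <= d < n.+1 | (d %| n)%N && (p %| d)%N) moebius d
   = \sum_(1 <= d < n.+1 | (p %| d)%N) (if (d %| n)%N then moebius d else 0).
  rewrite [LHS]big_mkcond [RHS]big_mkcond; apply: eq_bigr => d _.
  by do ?case: ifP => //=; case: (d %| n)%N.
have nm : (n %/ p = m)%N by rewrite nE mulKn.
rewrite sum_multiples // nm.
have -> : \sum_(1 <= d < m.+1) (if (p * d %| n)%N then moebius (p * d) else 0) =
    - \sum_(1 <= d < m.+1 | (d %| m)%N && ~~ (p %| d)%N) moebius d.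
  rewrite [in RHS]big_mkcond -sumrN; apply: eq_big_nat => d /andP[d0 _].
  rewrite nE dvdn_pmul2l // moebius_mul_prime //.
  by do ?case: ifP => //=; rewrite ?oppr0.
rewrite addrC; apply/eqP; rewrite subr_eq0; apply/eqP.
have cop d : ~~ (p %| d)%N -> (d %| n)%N = (d %| m)%N.
  by move=> pd; rewrite nE Gauss_dvdr // coprime_sym prime_coprime.
rewrite (@big_cat_nat _ _ _ m.+1) ?ltnS ?(ltnW mn) //=.
rewrite [X in _ + X]big1_seq ?addr0.
  apply: eq_bigl => d; case: (boolP (p %| d)%N) => [_|pd]; rewrite ?andbF //.
  by rewrite cop.
move=> d /andP[/andP[dn pd]]; rewrite cop // in dn; rewrite mem_index_iota.
by have := dvdn_leq m0 dn; lia.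
Qed.

(** Up to the term for [n = 1], [x] may be replaced by [ln n]. Expanding [ln (n / d)] as a sum of
    [mangoldt e] and exchanging the sums leaves only [e = n]. *)
Lemma sum_moebius_ln n (x : R) : (0 < n)%N ->
  \sum_(1 <= d < n.+1 | (d %| n)%N) moebius d * (x - ln d%:R) =
  x * (n == 1%N)%:R + mangoldt n.
Proof.
move=> n0.
under eq_bigr do rewrite mulrBr.
rewrite sumrB -mulr_suml sum_moebius_divisors // mulrC; congr (_ + _).
have lnE d : (0 < d <= n)%N -> (d %| n)%N ->
    ln (n%:R : R) - ln d%:R = \sum_(1 <= e < n.+1 | (d * e %| n)%N) mangoldt e.
  move=> /andP[d0 _] dn; have q0 : (0 < n %/ d)%N by rewrite divn_gt0 // dvdn_leq.
  rewrite -ln_div ?posrE ?ltr0n // -[X in ln (X%:R / _)](divnK dn) natrM mulfK; last first.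
    by rewrite pnatr_eq0; lia.
  rewrite -sum_mangoldt_divisors // (@sum_divisors_widen _ n) ?q0 ?leq_div //.
  by apply: eq_bigl => e; rewrite dvdn_divRL // mulnC.
transitivity (\sum_(1 <= d < n.+1 | (d %| n)%N) moebius d * (ln n%:R - ln d%:R)).
  under [RHS]eq_bigr do rewrite mulrBr.
  rewrite sumrB -mulr_suml sum_moebius_divisors //.
  case: eqVneq => [->|_]; first by rewrite ln1 mulr0 sub0r.
  by rewrite mul0r sub0r.
transitivity (\sum_(1 <= d < n.+1) \sum_(1 <= e < n.+1 | (d * e %| n)%N)
   moebius d * mangoldt e).
  rewrite big_mkcond; apply: eq_big_nat => d dn; case: ifP => [ddn|/negbT ddn].
    by rewrite lnE // mulr_sumr.
  rewrite big1 // => e den; case/negP: ddn.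
  by apply: dvdn_trans den; apply: dvdn_mulr.
rewrite (exchange_big_dep xpredT) //= big_nat_recr //= big1_seq ?add0r.
  transitivity (moebius 1 * mangoldt n); last by rewrite /moebius /= mul1r.
  rewrite big_mkcond big_nat_recl //= mul1n dvdnn big1_seq ?addr0 // => d.
  rewrite mem_index_iota => /andP[_ /andP[d0 dn]]; case: ifP => // /dvdn_leq -/(_ n0).
  by nia.
move=> e; rewrite mem_index_iota => /andP[_ /andP[e0 en]].
have [edn|edn] := boolP (e %| n)%N; last first.
  by rewrite big1 // => d den; case/negP: edn; apply: dvdn_trans den; apply: dvdn_mull.
have q0 : (0 < n %/ e)%N by rewrite divn_gt0 // dvdn_leq.
rewrite -mulr_suml.
rewrite (eq_bigl (fun d => d %| n %/ e)%N); last by move=> d; rewrite dvdn_divRL.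
rewrite -(@sum_divisors_widen _ n) ?q0 ?leq_div // sum_moebius_divisors //.
have -> : (n %/ e == 1)%N = false; last by rewrite mul0r.
by apply/negP => /eqP q1; have := divnK edn; rewrite q1; lia.
Qed.

Definition psi N : R := \sum_(1 <= n < N.+1) mangoldt n.
Definition lnfact N : R := \sum_(1 <= n < N.+1) ln n%:R.

Lemma lnfact_mangoldt N :
  lnfact N = \sum_(1 <= d < N.+1) mangoldt d * (N %/ d)%:R.
Proof.
rewrite /lnfact.
under eq_big_nat => n /andP[n0 _] do rewrite -sum_mangoldt_divisors //.
rewrite (sum_divisors_exchange N (fun d _ => mangoldt d)).
by apply: eq_bigr => d _; rewrite sumr_const_nat subn1 mulr_natr.
Qed.

Lemma lnfact_psi N : lnfact N = \sum_(1 <= m < N.+1) psi (N %/ m).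
Proof.
rewrite /lnfact.
under eq_big_nat => n /andP[n0 _] do rewrite -sum_mangoldt_divisors //.
rewrite (sum_divisors_exchange N (fun d _ => mangoldt d)) /psi.
transitivity (\sum_(1 <= d < N.+1) \sum_(1 <= m < N.+1 | (d * m < N.+1)%N) mangoldt d).
  apply: eq_big_nat => d /andP[d0 dN].
  rewrite [RHS](@big_cat_nat _ _ _ (N %/ d).+1) //= ?ltnS ?leq_div //.
  rewrite [X in _ = _ + X]big1_seq ?addr0.
    rewrite [LHS]big_nat_cond [RHS]big_nat_cond; apply: eq_bigl => m /=.
    case: (boolP ((0 < m) && (m < (N %/ d).+1))%N) => //= /andP[m0].
    by rewrite !ltnS leq_divRL // mulnC => ->.
  move=> m /andP[dm]; rewrite mem_index_iota => /andP[]; rewrite ltn_divLR //; lia.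
rewrite (exchange_big_dep xpredT) //=.
apply: eq_big_nat => m /andP[m0 mN].
rewrite (@big_cat_nat _ _ _ (N %/ m).+1) //= ?ltnS ?leq_div //.
rewrite [X in _ + X]big1_seq ?addr0.
  rewrite [LHS]big_nat_cond [RHS]big_nat_cond; apply: eq_bigl => d /=.
  case: (boolP ((0 < d) && (d < (N %/ m).+1))%N) => //= /andP[d0].
  by rewrite !ltnS leq_divRL // => ->.
move=> d /andP[dm]; rewrite mem_index_iota => /andP[]; rewrite ltn_divLR //; lia.
Qed.

End NumberTheory.

(** * Estimates of Chebyshev and Mertens *)

Section Mertens.
Variable R : realType.
Implicit Types (n m d p N M : nat).
Local Notation psi := (@psi R).
Local Notation lnfact := (@lnfact R).
Local Notation mangoldt := (@mangoldt R).

Lemma lnS_sub n : (0 < n)%N ->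
  n.+1%:R^-1 <= ln (n.+1%:R : R) - ln n%:R <= n%:R^-1.
Proof.
move=> n0.
have p0 : 0 < n%:R :> R by rewrite ltr0n.
have p1 : 0 < n.+1%:R :> R by rewrite ltr0n.
have E : n.+1%:R = n%:R + 1 :> R by rewrite -addn1 natrD.
have := ln_subW p0 p1; have := ln_subW p1 p0.
rewrite [_ - n%:R]addrC E addKr mul1r opprD addrA subrr sub0r mulNr mul1r.
by move=> a b; apply/andP; split; lra.
Qed.

Lemma lnfactS n : lnfact n.+1 = lnfact n + ln n.+1%:R.
Proof. by rewrite /lnfact big_nat_recr. Qed.

(** A weak form of Stirling's formula for [ln n!], by induction. *)
Lemma lnfact_bounds n : (0 < n)%N ->
  n%:R * ln n%:R - n%:R + 1 <= lnfact n <= n%:R * ln n%:R - n%:R + 1 + ln n%:R.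
Proof.
elim: n => // -[|n] IH _.
  by rewrite /lnfact big_nat1 ln1; apply/andP; split; lra.
have /andP[l u] := IH isT; rewrite lnfactS.
have /andP := @lnS_sub n.+1 isT.
have p0 : 0 < n.+1%:R :> R by rewrite ltr0n.
have p1 : 0 < n.+2%:R :> R by rewrite ltr0n.
have E : n.+2%:R = n.+1%:R + 1 :> R by rewrite -[in LHS]addn1 natrD.
move=> [a b].
have {}a : 1 <= n.+2%:R * (ln n.+2%:R - ln n.+1%:R) :> R.
  by rewrite -ler_pdivrMl // mulr1.
have {}b : n.+1%:R * (ln n.+2%:R - ln n.+1%:R) <= 1 :> R.
  by rewrite -ler_pdivlMl // mulr1.
by rewrite E in a b *; apply/andP; split; lra.
Qed.

(** Chebyshev's argument: the coefficient of [mangoldt d] on the right is nonnegative, and it is 1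
    when [N %/ 2 < d <= N]. *)
Lemma lnfact_half_psi N : psi N - psi (N %/ 2) <= lnfact N - lnfact (N %/ 2) *+ 2.
Proof.
set M := (N %/ 2)%N.
have MN : (M <= N)%N by rewrite leq_div.
have -> : lnfact M = \sum_(1 <= d < N.+1) mangoldt d * (M %/ d)%:R.
  rewrite lnfact_mangoldt [RHS](@big_cat_nat _ _ _ M.+1) ?ltnS //=.
  rewrite [X in _ + X]big1_seq ?addr0 // => d; rewrite mem_index_iota.
  by move=> /andP[_ /andP[Md _]]; rewrite divn_small // mulr0.
have -> : psi N - psi M = \sum_(1 <= d < N.+1) mangoldt d * (M < d)%N%:R.
  rewrite /psi (@big_cat_nat _ _ _ M.+1) ?ltnS //= addrAC subrr add0r.
  rewrite [RHS](@big_cat_nat _ _ _ M.+1) ?ltnS //=.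
  rewrite [X in _ = X + _]big1_seq ?add0r; last first.
    by move=> d; rewrite mem_index_iota => /andP[_ /andP[_ dM]]; rewrite ltnNge -ltnS dM mulr0.
  by apply: eq_big_nat => d /andP[-> _]; rewrite mulr1.
rewrite lnfact_mangoldt -sumrMnl -sumrB [X in X <= _]big_nat [X in _ <= X]big_nat.
apply: ler_sum => d /andP[d0 dN].
rewrite -mulrnAr -mulrBr ler_wpM2l ?mangoldt_ge0 // -mulrnA.
rewrite lerBrDr -natrD ler_nat /M.
have -> : (N %/ 2 %/ d = N %/ d %/ 2)%N by rewrite -!divnMA mulnC.
case: ltnP => [Md|_]; last by lia.
have : (0 < N %/ d)%N by rewrite divn_gt0.
have : (N %/ d < 2)%N by rewrite ltn_divLR //; lia.
by lia.
Qed.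

Lemma psi_ge0 N : 0 <= psi N.
Proof. by apply: sumr_ge0 => n _; apply: mangoldt_ge0. Qed.

Lemma psiB m n : (m <= n)%N -> psi n - psi m = \sum_(m.+1 <= k < n.+1) mangoldt k.
Proof. by move=> mn; rewrite /psi (@big_cat_nat _ _ _ m.+1) ?ltnS //= addrAC subrr add0r. Qed.

Lemma psi_le m n : (m <= n)%N -> psi m <= psi n.
Proof.
move=> mn; rewrite -subr_ge0 psiB //.
by apply: sumr_ge0 => k _; apply: mangoldt_ge0.
Qed.

Lemma lnfact_half_le N : (1 < N)%N -> lnfact N - lnfact (N %/ 2) *+ 2 <= 4 * N%:R.
Proof.
move=> N1; set M := (N %/ 2)%N.
have M0 : (0 < M)%N by rewrite divn_gt0.
have /andP[_ u] := @lnfact_bounds N (ltnW N1).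
have /andP[l _] := lnfact_bounds M0.
have [MN NM] : (2 * M <= N)%N /\ (N <= 2 * M + 1)%N by rewrite /M; lia.
have N0 : 0 < N%:R :> R by rewrite ltr0n; lia.
have MR : 1 <= M%:R :> R by rewrite ler1n.
have h1 : 2 * M%:R <= N%:R :> R by rewrite -natrM ler_nat.
have h2 : N%:R <= 2 * M%:R + 1 :> R by move: NM; rewrite -(ler_nat R) natrD natrM.
have h3 := ln_sublinear N0.
have h4 : ln N%:R - ln M%:R <= 2 :> R.
  apply: le_trans (ln_subW _ N0) _; first by lra.
  by rewrite ler_pdivrMr //; lra.
have h5 : (2 * M%:R) * (ln N%:R - ln M%:R) <= (2 * M%:R) * 2 :> R by rewrite ler_wpM2l //; lra.
have h6 : (N%:R - 2 * M%:R) * ln N%:R <= 1 * ln N%:R :> R.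
  by rewrite ler_wpM2r ?lnnat_ge0 //; lra.
by rewrite mulr2n; lra.
Qed.

(** Halving: [psi N <= 4 * N + psi (N %/ 2)], and the geometric series sums to [8 * N]. *)
Lemma psi_le8 N : psi N <= 8 * N%:R.
Proof.
elim/ltn_ind: N => N IH; have [N1|N1] := leqP N 1.
  have -> : psi N = 0; last by rewrite mulr_ge0.
  by case: N N1 {IH} => [|[|//]] _; rewrite /psi ?big_nil // big_nat1.
have := IH (N %/ 2)%N; rewrite ltn_Pdiv ?(ltnW N1) // => /(_ isT) h.
have := lnfact_half_psi N; have := lnfact_half_le N1.
have : (N %/ 2)%:R * 2 <= N%:R :> R by rewrite -natrM ler_nat; lia.
lra.
Qed.

Definition logpsi N : R := \sum_(1 <= n < N.+1) mangoldt n / n%:R.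

(** Removing the integer parts in [lnfact_mangoldt] turns [lnfact N] into [N * logpsi N], with an
    error of at most [psi N <= 8 * N]. *)
Lemma mertens N : (0 < N)%N -> `|logpsi N - ln N%:R| <= 8.
Proof.
move=> N0; have /andP[l u] := @lnfact_bounds N N0.
have NR : 1 <= N%:R :> R by rewrite ler1n.
have N0' : 0 < N%:R :> R by rewrite ltr0n.
have lo : lnfact N <= N%:R * logpsi N.
  rewrite lnfact_mangoldt mulr_sumr !big_nat; apply: ler_sum => d /andP[d0 _].
  rewrite mulrCA ler_wpM2l ?mangoldt_ge0 // ler_pdivlMr ?ltr0n //.
  by rewrite -natrM ler_nat leq_trunc_div.
have up : N%:R * logpsi N <= lnfact N + psi N.
  rewrite lnfact_mangoldt mulr_sumr /psi -big_split !big_nat /=.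
  apply: ler_sum => d /andP[d0 _].
  rewrite mulrCA -[X in _ <= _ + X]mulr1 -mulrDr ler_wpM2l ?mangoldt_ge0 //.
  rewrite ler_pdivrMr ?ltr0n // -[1]/(1%:R) -natrD -natrM ler_nat addn1.
  by apply: ltnW; apply: ltn_ceil.
have p8 := psi_le8 N.
have lnN : ln N%:R <= N%:R - 1 :> R by apply: ln_leB1.
rewrite ler_norml; apply/andP; split; rewrite -(ler_pM2l N0'); lra.
Qed.

End Mertens.

(** * Selberg's symmetry formula *)

Section Selberg.
Variable R : realType.
Implicit Types (n m d p N M : nat).
Local Notation psi := (@psi R).
Local Notation lnfact := (@lnfact R).
Local Notation mangoldt := (@mangoldt R).
Local Notation moebius := (@moebius R).

(** This decreases to Euler's constant, for which it stands in below. *)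
Definition euler N : R := \sum_(1 <= n < N.+1) n%:R^-1 - ln N%:R.

Lemma euler_sub M N : (0 < M <= N)%N ->
  0 <= euler M - euler N <= M%:R^-1 - N%:R^-1.
Proof.
move=> /andP[M0]; elim: N => [|N IH]; first by lia.
rewrite leq_eqVlt ltnS => /orP[/eqP->|MN]; first by rewrite !subrr lexx.
have /andP[l u] := IH MN.
have E : euler N.+1 = euler N + (N.+1%:R^-1 - (ln N.+1%:R - ln N%:R)).
  by rewrite /euler big_nat_recr //=; ring.
have /andP[l' u'] := @lnS_sub R N (leq_trans M0 MN).
rewrite E; move: (N.+1%:R^-1) (ln N.+1%:R) l' u' => i j l' u'.
by apply/andP; split; lra.
Qed.

Lemma euler_bounds N : (0 < N)%N -> 0 <= euler N <= 1.
Proof.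
move=> N0; have := @euler_sub 1 N; rewrite N0 => /(_ isT).
rewrite /(euler 1) big_nat1 ln1 invr1.
have : 0 <= N%:R^-1 :> R by rewrite invr_ge0.
by move=> ? /andP[? ?]; apply/andP; split; lra.
Qed.

(** The constant [euler N + 1] makes the main terms cancel when the weight is summed over the
    multiples of [d]; what is left is logarithmic in [N / d]. *)
Definition selberg_weight N n : R :=
  psi (N %/ n) - N%:R / n%:R + (euler N + 1).

Lemma selberg_weight_sum N d : (0 < d <= N)%N ->
  `|\sum_(1 <= m < (N %/ d).+1) selberg_weight N (d * m)| <=
  1 + ln (N%:R / d%:R).
Proof.
move=> /andP[d0 dN]; set M := (N %/ d)%N; set y := N%:R / d%:R.
have M0 : (0 < M)%N by rewrite divn_gt0.
have dR : 0 < d%:R :> R by rewrite ltr0n.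
have -> : \sum_(1 <= m < M.+1) selberg_weight N (d * m) =
    lnfact M - y * (euler M + ln M%:R) + (euler N + 1) * M%:R.
  rewrite lnfact_psi /selberg_weight big_split /= sumrB; congr (_ - _ + _).
  - by apply: eq_bigr => m _; rewrite divnMA.
  - rewrite /euler subrK mulr_sumr; apply: eq_bigr => m _.
    by rewrite natrM invfM mulrA.
  - by rewrite sumr_const_nat subn1 mulr_natr.
have MR : 1 <= M%:R :> R by rewrite ler1n.
have M0R : 0 < M%:R :> R by rewrite ltr0n.
have My : M%:R <= y by rewrite ler_pdivlMr // -natrM ler_nat leq_trunc_div.
have yM : y <= M%:R + 1.
  rewrite ler_pdivrMr // -[1]/(1%:R) -natrD -natrM ler_nat addn1.
  by apply: ltnW; apply: ltn_ceil.
have /andP[l u] := @lnfact_bounds R M M0.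
have lM : 0 <= ln M%:R :> R := lnnat_ge0 R M.
have lMy : ln M%:R <= ln y by rewrite ler_ln ?posrE //; lra.
have /andP[g1 g2] : 0 <= euler M - euler N <= M%:R^-1.
  have := @euler_sub M N; rewrite M0 leq_div => /(_ isT)/andP[-> /le_trans->//].
  by rewrite lerBlDr lerDl invr_ge0.
have g3 : M%:R * (euler M - euler N) <= 1 by rewrite -ler_pdivlMl // mulr1.
have g4 : 0 <= M%:R * (euler M - euler N) by rewrite mulr_ge0 //; lra.
have /andP[e0 e1] := euler_bounds M0.
have a1 : 0 <= (y - M%:R) * ln M%:R by rewrite mulr_ge0 //; lra.
have a2 : (y - M%:R) * ln M%:R <= 1 * ln M%:R by rewrite ler_wpM2r //; lra.
have a3 : 0 <= (y - M%:R) * euler M by rewrite mulr_ge0 //; lra.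
have a4 : (y - M%:R) * euler M <= 1 * 1 by rewrite ler_pM //; lra.
rewrite ler_norml; apply/andP; split; lra.
Qed.

Lemma ge1_sqrtr (y : R) : 1 <= y -> 1 <= Num.sqrt y.
Proof. by move=> y1; rewrite -sqrtr1 ler_wsqrtr. Qed.

(** With [y = s ^ 4] one has [4 * ln s <= 2 * s ^ 2] and [16 * ln s ^ 2 <= 16 * s ^ 2]. *)
Lemma ln_sqr_sqrt (y : R) : 1 <= y -> ln y * (1 + ln y) <= 18 * Num.sqrt y.
Proof.
move=> y1; set s := Num.sqrt (Num.sqrt y).
have s1 : 1 <= s by rewrite !ge1_sqrtr.
have sE : Num.sqrt y = s ^+ 2 by rewrite sqr_sqrtr // sqrtr_ge0.
have yE : y = s ^+ 4 by rewrite (exprM s 2 2) -sE sqr_sqrtr //; lra.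
have h1 : ln s <= s by apply/ltW/ln_sublinear; lra.
have h2 : 0 <= ln s by apply: ln_ge0.
have h3 : ln s * ln s <= s * s by rewrite ler_pM.
have h4 : ln s <= s ^+ 2 / 2.
  apply: le_trans (ln_leB1 _) _; first by lra.
  have := sqr_ge0 (s - 1); rewrite expr2 => ?; rewrite expr2; lra.
rewrite sE yE lnXn; last by lra.
rewrite -mulr_natl expr2 in h4 *; lra.
Qed.

Lemma sum_inv_sqrt N : \sum_(1 <= d < N.+1) (Num.sqrt d%:R)^-1 <= 2 * Num.sqrt N%:R :> R.
Proof.
elim: N => [|N IH]; first by rewrite big_nil sqrtr0 mulr0.
rewrite big_nat_recr //=; set a := Num.sqrt N%:R in IH *; set b := Num.sqrt N.+1%:R.
have b0 : 0 < b by rewrite sqrtr_gt0 ltr0n.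
have ab : b ^+ 2 = a ^+ 2 + 1 by rewrite !sqr_sqrtr // -natr1.
apply: le_trans (lerD IH (lexx _)) _.
rewrite -(ler_pM2r b0) mulrDl mulVf ?gt_eqF //.
by have := sqr_ge0 (a - b); move: ab; rewrite !expr2; lra.
Qed.

(* Tatuzawa-Iseki identity: the sum of [moebius d * ln (N / d)] over [d | n] is
   [mangoldt n], plus [ln N] when [n = 1]. *)
Lemma tatuzawa_iseki N (F : nat -> R) : (0 < N)%N ->
  \sum_(1 <= d < N.+1) moebius d * (ln N%:R - ln d%:R) *
     \sum_(1 <= m < (N %/ d).+1) F (d * m)%N =
  F 1%N * ln N%:R + \sum_(1 <= n < N.+1) mangoldt n * F n.
Proof.
move=> N0.
transitivity (\sum_(1 <= d < N.+1) \sum_(1 <= m < (N %/ d).+1)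
    moebius d * (ln N%:R - ln d%:R) * F (d * m)%N).
  by apply: eq_bigr => d _; rewrite mulr_sumr.
rewrite -(sum_divisors_exchange N (fun d n => moebius d * (ln N%:R - ln d%:R) * F n)).
transitivity (\sum_(1 <= n < N.+1) (ln N%:R * (n == 1%N)%:R + mangoldt n) * F n).
  by apply: eq_big_nat => n /andP[n0 _]; rewrite -mulr_suml sum_moebius_ln.
under eq_bigr do rewrite mulrDl.
rewrite big_split /=; congr (_ + _).
rewrite big_nat_recl //= mulr1 mulrC big1_seq ?addr0 // => i.
rewrite mem_index_iota => /andP[_ /andP[i0 _]].
by rewrite gtn_eqF // mulr0 mul0r.
Qed.

Definition selberg_sum N : R :=
  psi N * ln N%:R + \sum_(1 <= n < N.+1) mangoldt n * psi (N %/ n).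

(** The Tatuzawa-Iseki identity for [selberg_weight N], where Mertens' estimate supplies the second
    [N * ln N]. The constant is 36 from the left side, 8 from Mertens, and 16 and 2 from
    [(euler N + 1) * (psi N + ln N)]. *)
Lemma selberg N : (0 < N)%N ->
  `|selberg_sum N - 2 * (N%:R * ln N%:R)| <= 62 * N%:R.
Proof.
move=> N0; have NR : 1 <= N%:R :> R by rewrite ler1n.
have NR0 : 0 < N%:R :> R by rewrite ltr0n.
have T := tatuzawa_iseki (selberg_weight N) N0.
have B : `|\sum_(1 <= d < N.+1) moebius d * (ln N%:R - ln d%:R) *
     \sum_(1 <= m < (N %/ d).+1) selberg_weight N (d * m)| <= 36 * N%:R.
  apply: le_trans (ler_norm_sum _ _ _) _.
  apply: (@le_trans _ _ (\sum_(1 <= d < N.+1) 18 * Num.sqrt N%:R * (Num.sqrt d%:R)^-1)).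
    rewrite !big_nat; apply: ler_sum => d /andP[d0 dN].
    have dR : 0 < d%:R :> R by rewrite ltr0n.
    have y1 : 1 <= N%:R / d%:R :> R by rewrite ler_pdivlMr // mul1r ler_nat.
    rewrite -[X in _ <= X]mulrA -sqrtrV ?(ltW dR) // -sqrtrM ?(ltW NR0) //.
    apply: le_trans (ln_sqr_sqrt y1).
    rewrite -ln_div ?posrE // !normrM [X in _ * X * _]ger0_norm ?ln_ge0 //.
    rewrite -[X in _ <= X]mul1r -mulrA ler_pM ?mulr_ge0 ?ln_ge0 ?moebius_le1 //.
    by rewrite ler_wpM2l ?ln_ge0 //; apply: selberg_weight_sum; rewrite d0.
  rewrite -mulr_sumr; have := sum_inv_sqrt N.
  have s0 : 0 <= Num.sqrt N%:R :> R by apply: sqrtr_ge0.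
  move=> /(ler_wpM2l s0).
  rewrite [in X in _ <= X -> _]mulrCA -expr2 sqr_sqrtr // => h; lra.
rewrite T in B; move: B.
have -> : \sum_(1 <= n < N.+1) mangoldt n * selberg_weight N n =
   \sum_(1 <= n < N.+1) mangoldt n * psi (N %/ n) - N%:R * logpsi R N +
   (euler N + 1) * psi N.
  rewrite (_ : psi N = \sum_(1 <= n < N.+1) mangoldt n) //.
  rewrite /logpsi !mulr_sumr -sumrB -big_split; apply: eq_bigr => n _.
  by rewrite /selberg_weight /=; ring.
rewrite /selberg_weight divn1 divr1 /selberg_sum.
have := mertens R N0; rewrite ler_norml => /andP[m1 m2].
have /andP[e0 e1] := euler_bounds N0.
have p8 := psi_le8 R N; have p0 := psi_ge0 R N.
have l0 := lnnat_ge0 R N; have l1 := ln_sublinear NR0.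
have a1 : 0 <= (euler N + 1) * psi N by rewrite mulr_ge0 //; lra.
have a2 : (euler N + 1) * psi N <= 2 * psi N by rewrite ler_wpM2r //; lra.
have b1 : 0 <= (euler N + 1) * ln N%:R by rewrite mulr_ge0 //; lra.
have b2 : (euler N + 1) * ln N%:R <= 2 * ln N%:R by rewrite ler_wpM2r //; lra.
have c1 : N%:R * (logpsi R N - ln N%:R) <= N%:R * 8 by rewrite ler_wpM2l //; lra.
have c2 : N%:R * - 8 <= N%:R * (logpsi R N - ln N%:R) by rewrite ler_wpM2l //; lra.
rewrite !ler_norml => /andP[t1 t2]; apply/andP; split; lra.
Qed.

End Selberg.

(** * Primes in short intervals *)

Section Gaps.
Variable R : realType.
Implicit Types (n m d p N M : nat) (eps eta sigma tau h : R).
Local Notation psi := (@psi R).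
Local Notation logpsi := (@logpsi R).
Local Notation mangoldt := (@mangoldt R).

Lemma ln_nat_unbounded (x : R) : exists N0, forall N, (N0 <= N)%N -> x <= ln N%:R.
Proof.
exists (Num.bound (expR x)) => N N0N.
have e0 : 0 < expR x := expR_gt0 x.
have eN : expR x < N%:R.
  have := archi_boundP (ltW e0); move=> /lt_le_trans; apply.
  by rewrite ler_nat.
by rewrite -[x]expRK ler_ln ?posrE ?ltW //; lra.
Qed.

(** Take the least integer [m >= n * expR u]; rounding up changes the logarithm by at most
    [1 / n]. *)
Lemma nat_log_approx sigma : 0 < sigma -> exists A, forall n (u : R),
  (A <= n)%N -> 0 <= u -> exists m,
  [/\ ln n%:R + u <= ln m%:R :> R, ln m%:R <= ln n%:R + u + sigma,
     (n <= m)%N & forall k, ln n%:R + u <= ln k%:R -> (0 < k)%N -> (m <= k)%N].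
Proof.
move=> s0; exists (Num.bound sigma^-1).+1 => n u An u0.
have n0 : (0 < n)%N by lia.
have nR : 0 < n%:R :> R by rewrite ltr0n.
set x := n%:R * expR u.
have lx : ln x = ln n%:R + u by rewrite lnM ?posrE ?expR_gt0 // expRK.
have e1 : 1 <= expR u by rewrite -expR0 ler_expR.
have x0 : 0 < x by rewrite mulr_gt0 // expR_gt0.
have nx : n%:R <= x by rewrite /x ler_pMr.
have exm : exists m, x <= m%:R.
  by exists (Num.bound x); apply/ltW/archi_boundP/ltW.
have [m xm mmin] := ex_minnP exm.
have nm : (n <= m)%N by rewrite -(ler_nat R); apply: le_trans xm.
have m0 : 0 < m%:R :> R by rewrite (lt_le_trans x0).
exists m; split=> //.
- by rewrite -lx ler_ln ?posrE.
- have mx : m%:R <= x + 1.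
    case: m {exm nm m0} xm mmin => [|m] _ mmin; first by lra.
    rewrite -natr1 lerD2r; rewrite leNgt; apply/negP => /ltW/mmin; lia.
  have := ln_subW x0 m0; rewrite -lx => H; rewrite -lerBlDl; apply: le_trans H _.
  rewrite ler_pdivrMr //; apply: (@le_trans _ _ 1); first by lra.
  rewrite -ler_pdivrMl // mulr1; apply: le_trans nx.
  apply: (@le_trans _ _ (Num.bound sigma^-1)%:R); last by rewrite ler_nat; lia.
  by apply/ltW/archi_boundP; rewrite invr_ge0 ltW.
- move=> k lk k0; apply: mmin.
  by rewrite -ler_ln ?posrE ?ltr0n // lx.
Qed.

Lemma ratio_le_expR m n (u : R) : (0 < n)%N -> (0 < m)%N ->
  ln m%:R <= ln n%:R + u -> m%:R <= n%:R * expR u.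
Proof.
move=> n0 m0 H; rewrite -ler_ln ?posrE ?mulr_gt0 ?expR_gt0 ?ltr0n //.
by rewrite lnM ?posrE ?expR_gt0 ?ltr0n // expRK.
Qed.

(** The difference of two instances of [selberg]: 62 for each end, and 8 for writing [ln N'] instead
    of [ln N] next to [psi N]. *)
Lemma selberg_sub N N' : (0 < N <= N')%N ->
  `|(psi N' - psi N) * ln N'%:R +
    \sum_(1 <= n < N'.+1) mangoldt n * (psi (N' %/ n) - psi (N %/ n)) -
    2 * (N'%:R - N%:R) * ln N'%:R| <= 132 * N'%:R.
Proof.
move=> /andP[N0 NN'].
have /ler_normlP[s1 s2] := selberg R N0.
have /ler_normlP[t1 t2] := selberg R (leq_trans N0 NN').
have E : \sum_(1 <= n < N'.+1) mangoldt n * (psi (N' %/ n) - psi (N %/ n)) =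
   \sum_(1 <= n < N'.+1) mangoldt n * psi (N' %/ n) -
   \sum_(1 <= n < N.+1) mangoldt n * psi (N %/ n).
  under eq_bigr do rewrite mulrBr.
  rewrite sumrB; congr (_ - _).
  rewrite (@big_cat_nat _ _ _ N.+1) //= [X in _ + X]big1_seq ?addr0 // => n.
  rewrite mem_index_iota => /andP[_ /andP[Nn _]].
  by rewrite divn_small // /psi big_nil mulr0.
have NR : 0 < N%:R :> R by rewrite ltr0n.
have NN'R : N%:R <= N'%:R :> R by rewrite ler_nat.
have l1 : 0 <= ln N'%:R - ln N%:R :> R by rewrite subr_ge0 ler_lnnat.
have l2 : N%:R * (ln N'%:R - ln N%:R) <= N'%:R - N%:R :> R.
  by rewrite -ler_pdivlMl // mulrC ln_subW //; lra.
have p1 : 0 <= psi N * (ln N'%:R - ln N%:R) by rewrite mulr_ge0 ?psi_ge0.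
have p2 : psi N * (ln N'%:R - ln N%:R) <= 8 * N%:R * (ln N'%:R - ln N%:R).
  by rewrite ler_wpM2r ?psi_le8.
have p3 : 0 <= N%:R * (ln N'%:R - ln N%:R) :> R by rewrite mulr_ge0 // ltW.
rewrite E; rewrite /selberg_sum in s1 s2 t1 t2.
by apply/ler_normlP; split; lra.
Qed.

Lemma psiB_ge0 m n : (m <= n)%N -> 0 <= psi n - psi m.
Proof. by move=> mn; rewrite subr_ge0 psi_le. Qed.

(** Drop the nonnegative convolution sum in [selberg_sub] and divide by [ln b]. *)
Lemma psi_upper_density eta : 0 < eta -> exists B, (0 < B)%N /\ forall a b,
  (B <= b)%N -> (a <= b)%N -> psi b - psi a <= 2 * (b%:R - a%:R) + eta * b%:R.
Proof.
move=> e0; have [B HB] := ln_nat_unbounded (132 / eta + 1).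
exists B.+2; split=> // a b Bb ab.
wlog a0 : a ab / (0 < a)%N => [W|].
  case: a ab => [_|a ab]; last by apply: W.
  have := W 1%N; have -> : psi 1 = psi 0 by rewrite /psi big_nat1 big_nil.
  by move=> /(_ ltac:(lia) isT); lra.
have := selberg_sub (N := a) (N' := b); rewrite a0 ab => /(_ isT)/ler_normlP[_].
have : 0 <= \sum_(1 <= n < b.+1) mangoldt n * (psi (b %/ n) - psi (a %/ n)).
  by apply: sumr_ge0 => n _; rewrite mulr_ge0 ?mangoldt_ge0 ?psiB_ge0 ?leq_div2r.
have lb : 132 / eta + 1 <= ln b%:R by apply: HB; lia.
have l0 : 0 < 132 / eta by rewrite divr_gt0.
have lb0 : 0 < ln b%:R :> R by lra.
move=> S1 S2; rewrite -(ler_pM2r lb0).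
have : 132 <= eta * ln b%:R by rewrite mulrC -ler_pdivrMr //; lra.
move=> /(ler_wpM2r (ler0n R b)); lra.
Qed.

Lemma logpsiB m n : (m <= n)%N ->
  logpsi n - logpsi m = \sum_(m.+1 <= k < n.+1) mangoldt k / k%:R.
Proof.
by move=> mn; rewrite /logpsi (@big_cat_nat _ _ _ m.+1) ?ltnS //= addrAC subrr add0r.
Qed.

Lemma logpsi_le m n : (m <= n)%N -> logpsi m <= logpsi n.
Proof.
move=> mn; rewrite -subr_ge0 logpsiB //.
by apply: sumr_ge0 => k _; rewrite mulr_ge0 ?mangoldt_ge0 ?invr_ge0.
Qed.

(* The claim carries the term [(psi t - psi a - 2 (t - a) + E) / (t + 1)] of the
   partial summation so that it can be proved by induction on [t]. *)
Lemma logpsi_heavy a t (E : R) : (a <= t)%N ->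
  (forall s, (a <= s <= t)%N -> 2 * (s%:R - a%:R) - E <= psi s - psi a) ->
  2 * (ln t.+1%:R - ln a.+1%:R) - E / a.+1%:R <= logpsi t - logpsi a.
Proof.
move=> at_ H.
suff : 2 * (ln t.+1%:R - ln a.+1%:R) - E / a.+1%:R +
   (psi t - psi a - 2 * (t%:R - a%:R) + E) / t.+1%:R <= logpsi t - logpsi a.
  have := H t; rewrite at_ leqnn => /(_ isT) Ht.
  have : 0 <= (psi t - psi a - 2 * (t%:R - a%:R) + E) / t.+1%:R.
    by rewrite divr_ge0 //; lra.
  by move=> h1; apply: le_trans; rewrite lerDl.
elim: t at_ H => [|t IH].
  by case: a => [|a //] _ _; rewrite !subrr mulr0 subr0 !add0r addNr.
rewrite leq_eqVlt ltnS => /orP[/eqP <- _|at_ H].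
  by rewrite !subrr mulr0 subr0 !add0r addNr.
have {}IH := IH at_ (fun s sat => H s ltac:(case/andP: sat => -> /leqW ->; done)).
have := H t.+1; rewrite leqnn leqW // => /(_ isT) Ht.
have -> : logpsi t.+1 = logpsi t + mangoldt t.+1 / t.+1%:R.
  by rewrite /logpsi big_nat_recr.
have psiE : psi t.+1 = psi t + mangoldt t.+1 by rewrite /psi big_nat_recr.
have /andP[_ dl] := @lnS_sub R t.+1 isT.
have ij : t.+2%:R^-1 <= t.+1%:R^-1 :> R by rewrite lef_pV2 ?posrE ?ltr0n // ler_nat.
rewrite psiE -[in t.+1%:R - a%:R]natr1 in Ht *.
move: (t.+2%:R^-1) (t.+1%:R^-1) ij dl IH => j i ij dl IH.
have : 0 <= (psi t + mangoldt t.+1 - psi a - 2 * (t%:R + 1 - a%:R) + E) * (i - j).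
  by rewrite mulr_ge0 //; lra.
by move: (E / _) dl IH => q dl IH; lra.
Qed.

(** The shortfall of the mass of (N / n, N' / n] from the maximal density 2; the allowance with
    [eta] covers rounding and the error in [psi_upper_density]. *)
Definition slack eta N N' n :=
  (2 * (N'%:R - N%:R) + 2 * eta * N'%:R) / n%:R - (psi (N' %/ n) - psi (N %/ n)).

(* If (N, N'] carries little mass, Selberg's formula forces (N / n, N' / n] to
   have nearly the maximal density 2 for most n. *)
Lemma gap_slack eta B0 : 0 < eta -> exists B (C : R), [/\ (B0 <= B)%N, (0 < B)%N &
  forall N N', (0 < N <= N')%N -> (B <= N')%N -> psi N' - psi N <= eta * N'%:R ->
  (forall n, (0 < n <= N' %/ B)%N -> 0 <= slack eta N N' n) /\
  \sum_(1 <= n < (N' %/ B).+1) mangoldt n * slack eta N N' n <=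
    3 * eta * N'%:R * ln N'%:R + C * N'%:R].
Proof.
move=> e0; have [B1 [B10 HB1]] := psi_upper_density e0.
pose B := (B0 + B1 + Num.bound (2 / eta)).+1.
have B0R : 0 < B%:R :> R by rewrite ltr0n.
have Be : 2 <= eta * B%:R.
  rewrite mulrC -ler_pdivrMr //; apply: (@le_trans _ _ (Num.bound (2 / eta))%:R).
    by apply/ltW/archi_boundP; rewrite divr_ge0 ?ltW.
  by rewrite ler_nat /B; lia.
have [B1B B0B Bpos] : [/\ (B1 <= B)%N, (B0 <= B)%N & (0 < B)%N] by rewrite /B; split; lia.
(* The terms 16 and [16 * eta] come from Mertens for [logpsi X], 132 from [selberg_sub], and the
   rest from the [n] above [N' %/ B], where [psi] is bounded by [psi_le8]. *)
exists B, (16 + 16 * eta + 132 + 128 + 8 * ln (2 * B%:R)); split=> //.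
clearbody B => N N' /andP[N0 NN'] BN' gap.
have N'R : 0 < N'%:R :> R by rewrite ltr0n; lia.
have N'1 : 1 <= N'%:R :> R by rewrite ler1n; lia.
have NN'R : N%:R <= N'%:R :> R by rewrite ler_nat.
set X := (N' %/ B)%N.
have X0 : (0 < X)%N by rewrite divn_gt0.
have XN' : (X <= N')%N by rewrite leq_div.
split=> [n /andP[n0 nX]|].
  have nR : 0 < n%:R :> R by rewrite ltr0n.
  have nB : (n * B <= N')%N by rewrite -leq_divRL.
  have Bq : (B <= N' %/ n)%N by rewrite leq_divRL // mulnC.
  have := HB1 (N %/ n)%N (N' %/ n)%N (leq_trans B1B Bq) (leq_div2r n NN').
  have a1 : (N' %/ n)%:R <= N'%:R / n%:R :> R by rewrite ler_pdivlMr // -natrM ler_nat leq_trunc_div.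
  have a2 : N%:R / n%:R <= (N %/ n)%:R + 1 :> R.
    rewrite ler_pdivrMr // -[1]/(1%:R) -natrD -natrM ler_nat addn1.
    by apply: ltnW; apply: ltn_ceil.
  have a3 : B%:R <= N'%:R / n%:R :> R by rewrite ler_pdivlMr // -natrM ler_nat mulnC.
  have a4 := ler_wpM2l (ltW e0) a3; have a5 := ler_wpM2l (ltW e0) a1.
  rewrite /slack (_ : _ / _ = 2 * (N'%:R / n%:R) - 2 * (N%:R / n%:R) +
    2 * (eta * (N'%:R / n%:R))); last by ring.
  by move: (N'%:R / n%:R) (N%:R / n%:R) a1 a2 a3 a4 a5 => y x *; lra.
have -> : \sum_(1 <= n < X.+1) mangoldt n * slack eta N N' n =
   (2 * (N'%:R - N%:R) + 2 * eta * N'%:R) * logpsi X -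
   \sum_(1 <= n < X.+1) mangoldt n * (psi (N' %/ n) - psi (N %/ n)).
  rewrite /logpsi mulr_sumr -sumrB; apply: eq_bigr => n _.
  by rewrite /slack mulrBr mulrCA.
have /ler_normlP[S1 _] := @selberg_sub N N' ltac:(by rewrite N0).
have lX := logpsi_le XN'.
have /ler_normlP[_ m1] := mertens R (leq_trans X0 XN').
have /ler_normlP[m2 _] := mertens R X0.
have XB : N'%:R <= 2 * B%:R * X%:R :> R.
  rewrite -!natrM ler_nat; move: (leq_pmull B X0) (ltn_ceil N' Bpos).
  by rewrite -/X mulSn -mulnA (mulnC B); move: (X * B)%N => y; clear; lia.
have XR : 0 < X%:R :> R by rewrite ltr0n.
have lnX : ln N'%:R <= ln (2 * B%:R) + ln X%:R :> R.
  by rewrite -lnM ?posrE ?mulr_gt0 // ler_ln ?posrE ?mulr_gt0.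
have lN' : 0 <= ln N'%:R :> R := lnnat_ge0 R N'.
have S2 : \sum_(1 <= n < N'.+1) mangoldt n * (psi (N' %/ n) - psi (N %/ n)) <=
   \sum_(1 <= n < X.+1) mangoldt n * (psi (N' %/ n) - psi (N %/ n)) +
   8 * N'%:R * (logpsi N' - logpsi X).
  rewrite (@big_cat_nat _ _ _ X.+1) ?ltnS //= lerD2l logpsiB // mulr_sumr !big_nat.
  apply: ler_sum => n /andP[Xn _].
  have nR : 0 < n%:R :> R by rewrite ltr0n (leq_trans _ Xn).
  rewrite mulrCA; apply: ler_wpM2l; first exact: mangoldt_ge0.
  apply: (@le_trans _ _ (psi (N' %/ n))); first by rewrite lerBlDr lerDl psi_ge0.
  apply: le_trans (psi_le8 _ _) _; rewrite -mulrA ler_wpM2l //.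
  by rewrite ler_pdivlMr // -natrM ler_nat leq_trunc_div.
have b1 : (N'%:R - N%:R) * logpsi X <= (N'%:R - N%:R) * (ln N'%:R + 8).
  by rewrite ler_wpM2l //; lra.
have b2 : eta * N'%:R * logpsi X <= eta * N'%:R * (ln N'%:R + 8).
  by rewrite ler_wpM2l ?mulr_ge0 ?(ltW e0) //; lra.
have b3 : N'%:R * (logpsi N' - logpsi X) <= N'%:R * (16 + ln (2 * B%:R)).
  by rewrite ler_wpM2l //; lra.
have b4 := ler_wpM2r lN' gap.
have b5 : 0 <= N%:R :> R by [].
lra.
Qed.

Definition sparse (eps : R) N N' n :=
  psi (N' %/ n) - psi (N %/ n) < (2 * (N'%:R - N%:R) - eps * N'%:R) / n%:R.

(** Pigeonhole over the blocks from [A * M ^ j] to [A * M ^ j.+1]: there are about [ln N' / ln M] of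
    them, and by [gap_slack] the sparse [n] have too little total logarithmic mass to put [tau] into
    each. *)
Lemma sparse_block eps tau M A B0 : 0 < eps -> 0 < tau -> (1 < M)%N -> (0 < A)%N ->
  exists eta N1, 0 < eta /\ forall N N', (0 < N <= N')%N -> (N1 <= N')%N ->
  psi N' - psi N <= eta * N'%:R ->
  exists z, [/\ (A <= z)%N, (z * M * B0 <= N')%N &
    \sum_(z.+1 <= n < (z * M).+1 | sparse eps N N' n) mangoldt n / n%:R < tau].
Proof.
move=> eps0 tau0 M1 A0.
have M0R : 0 < M%:R :> R by rewrite ltr0n ltnW.
have lM : 0 < ln M%:R :> R by rewrite ln_gt0 // ltr1n.
(* The sparse mass is at most [(3 * eta * ln N' + C) / eps], so this [eta] uses three quarters of
   [tau * ln N' / ln M]; [N1] lets the last quarter absorb the bounded terms. *)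
pose eta := eps * tau / (4 * ln M%:R).
have eta0 : 0 < eta by rewrite divr_gt0 ?mulr_gt0.
have [B [C [B0B Bpos H]]] := gap_slack B0 eta0.
have AB0 : 0 < (A * B)%:R :> R by rewrite ltr0n muln_gt0 A0.
have [N1 HN1] := ln_nat_unbounded
  (4 * ln M%:R / tau * (C / eps + tau * ln (A * B)%:R / ln M%:R + tau) + 1).
exists eta, (N1 + A * B)%N; split=> // N N' NN' N1N' gap.
have ABN' : (A * B <= N')%N by lia.
have [|sl S] := H N N' NN' _ gap; first by nia.
set X := (N' %/ B)%N in sl S.
pose J := trunc_log M (N' %/ (A * B)).
have q0 : (0 < N' %/ (A * B))%N by rewrite divn_gt0 // muln_gt0 A0.
have /andP[J1 J2] := trunc_log_bounds M1 q0; rewrite -/J in J1 J2; clearbody J.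
pose f n := if sparse eps N N' n then mangoldt n / n%:R else 0.
have f0 n : 0 <= f n.
  by rewrite /f; case: ifP => // _; rewrite mulr_ge0 ?mangoldt_ge0 ?invr_ge0.
have AMJ : (A * M ^ J <= X)%N.
  rewrite /X leq_divRL //; move: J1; rewrite leq_divRL ?muln_gt0 ?A0 //.
  by rewrite mulnA [(_ ^ _ * A)%N]mulnC.
have N'R : 0 < N'%:R :> R by rewrite ltr0n; case/andP: NN'; apply: leq_trans.
have fS : eps * (\sum_(1 <= n < X.+1) f n) <= 3 * eta * ln N'%:R + C.
  rewrite -(ler_pM2l N'R) [X in _ <= X]mulrDr.
  have -> : N'%:R * (3 * eta * ln N'%:R) + N'%:R * C =
    3 * eta * N'%:R * ln N'%:R + C * N'%:R by ring.
  apply: le_trans S; rewrite !mulr_sumr !big_nat; apply: ler_sum => n /andP[n0 nX].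
  rewrite /f; case: ifP => [sp|_]; last by rewrite !mulr0 mulr_ge0 ?mangoldt_ge0 ?sl ?n0.
  rewrite (_ : N'%:R * _ = mangoldt n * (eps * N'%:R / n%:R)); last by ring.
  rewrite ler_wpM2l ?mangoldt_ge0 //.
  have : 0 <= eta * N'%:R / n%:R by rewrite divr_ge0 // mulr_ge0 ?ltW.
  by move: sp; rewrite /slack /sparse; lra.
suff [j jJ] : exists2 j, (j < J)%N &
    \sum_((A * M ^ j).+1 <= n < (A * M ^ j.+1).+1) f n < tau.
  move=> lt; exists (A * M ^ j)%N; split=> //.
  - by rewrite leq_pmulr // expn_gt0 ltnW.
  - rewrite -(mulnA A) -expnSr; apply: leq_trans (leq_trunc_div N' B); rewrite -/X.
    apply: leq_mul => //; apply: leq_trans AMJ; rewrite leq_mul2l leq_exp2l //.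
    by rewrite jJ orbT.
  - by rewrite big_mkcond -(mulnA A) -expnSr.
apply: contrapT => nex.
have big j : (j < J)%N -> tau <= \sum_((A * M ^ j).+1 <= n < (A * M ^ j.+1).+1) f n.
  by move=> jJ; rewrite leNgt; apply/negP => lt; apply: nex; exists j.
have bigJ j : (j <= J)%N -> j%:R * tau <= \sum_(1 <= n < (A * M ^ j).+1) f n.
  elim: j => [_|j IH jJ]; first by rewrite mul0r sumr_ge0.
  rewrite (@big_cat_nat _ _ _ (A * M ^ j).+1) //=; last first.
    by rewrite ltnS leq_mul2l leq_exp2l // leqnSn orbT.
  rewrite -natr1 mulrDl mul1r; apply: lerD; last exact: big.
  by apply: IH; apply: ltnW.
have JX : J%:R * tau <= \sum_(1 <= n < X.+1) f n.
  apply: le_trans (bigJ J (leqnn J)) _.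
  by rewrite [X in _ <= X](@big_cat_nat _ _ _ (A * M ^ J).+1) //= lerDl sumr_ge0.
have JlM : ln N'%:R <= ln (A * B)%:R + (J%:R + 1) * ln M%:R :> R.
  rewrite natr1 mulr_natl -lnXn // -natrX -lnM ?posrE ?ltr0n ?expn_gt0 ?muln_gt0 ?A0 ?(ltnW M1) //.
  rewrite -natrM; apply: ler_lnnat; first by case/andP: NN'; apply: leq_trans.
  by rewrite mulnC; apply: ltnW; rewrite -ltn_divLR // muln_gt0 A0.
have lnN' := HN1 N' (leq_trans (leq_addr _ _) N1N').
have k1 := ler_wpM2l (ltW eps0) JX.
have k2 : J%:R * (eps * tau) <= 3 * eta * ln N'%:R + C by lra.
have k3 : 3 * eta * ln N'%:R = eps * (3 / 4 * (tau / ln M%:R) * ln N'%:R).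
  by rewrite /eta; field; rewrite gt_eqF.
have k4 : ln N'%:R * (tau / ln M%:R) <= (tau * ln (A * B)%:R / ln M%:R + tau) + J%:R * tau.
  rewrite mulrA ler_pdivrMr //.
  have -> : (tau * ln (A * B)%:R / ln M%:R + tau + J%:R * tau) * ln M%:R =
    tau * (ln (A * B)%:R + (J%:R + 1) * ln M%:R) by field; rewrite gt_eqF.
  by rewrite [X in X <= _]mulrC ler_wpM2l ?(ltW tau0).
have t0 : 0 < tau / ln M%:R by rewrite divr_gt0.
have k5 : C / eps + tau * ln (A * B)%:R / ln M%:R + tau < tau / ln M%:R * ln N'%:R / 4.
  have := ler_wpM2l (ltW t0) lnN'; set Y := C / eps + _ + _.
  have -> : tau / ln M%:R * (4 * ln M%:R / tau * Y + 1) = 4 * Y + tau / ln M%:R.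
    by field; rewrite !gt_eqF.
  lra.
have k6 : J%:R * tau <= 3 / 4 * (tau / ln M%:R) * ln N'%:R + C / eps.
  rewrite -(ler_pM2l eps0) mulrDr -k3 [eps * (C / eps)]mulrC divfK ?gt_eqF //; lra.
lra.
Qed.

End Gaps.

(** * Shortening admissible intervals *)

Section Step.
Variable R : realType.
Implicit Types (n m d p N M : nat) (eps eta sigma tau h : R).
Local Notation psi := (@psi R).
Local Notation logpsi := (@logpsi R).
Local Notation mangoldt := (@mangoldt R).

(** The admissibility of the overview, with integer end points [N'] in place of [e^h N]. *)
Definition positive_density (h : R) := exists delta N0, [/\ 0 < delta, (0 < N0)%N &
  forall N N', (N0 <= N)%N -> ln N%:R + h <= ln N'%:R -> delta * N%:R <= psi N' - psi N].

Lemma divn_ratio_bounds N n : (0 < n)%N ->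
  (N %/ n)%:R <= N%:R / n%:R :> R /\ N%:R / n%:R <= (N %/ n).+1%:R :> R.
Proof.
move=> n0; have nR : 0 < n%:R :> R by rewrite ltr0n.
split; first by rewrite ler_pdivlMr // -natrM ler_nat leq_trunc_div.
by rewrite ler_pdivrMr // -natrM ler_nat; apply: ltnW; apply: ltn_ceil.
Qed.

Lemma ln_divn_bounds N n : (0 < n <= N)%N ->
  ln N%:R - ln n%:R <= ln (N %/ n).+1%:R :> R /\
  ln (N %/ n).+1%:R <= ln N%:R - ln n%:R + n%:R / N%:R :> R.
Proof.
move=> /andP[n0 nN]; have [l u] := divn_ratio_bounds N n0.
have nR : 0 < n%:R :> R by rewrite ltr0n.
have NR : 0 < N%:R :> R by rewrite ltr0n (leq_trans n0).
have qR : 0 < N%:R / n%:R :> R by rewrite divr_gt0.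
have sR : 0 < (N %/ n).+1%:R :> R by rewrite ltr0n.
rewrite -ln_div ?posrE //; split; first by rewrite ler_ln ?posrE.
rewrite addrC -lerBlDr; apply: le_trans (ln_subW qR sR) _.
rewrite invf_div -[X in _ <= X]mul1r ler_wpM2r ?divr_ge0 ?ler0n //.
by rewrite -natr1; lra.
Qed.

(** If [N %/ n] lies below [N' %/ n'], the whole stretch from [N %/ n'] to [N %/ n] has density
    almost 2. Otherwise it contains a full interval of logarithmic length almost [h], whose mass of
    about [2 * h] is spread over length at most [H + 4 * sigma]; [kappa] is the resulting average
    density. *)
Lemma heavy_step h H sigma eps kappa (B0 : nat) N N' n n' :
  0 < h <= H -> 0 < sigma -> 0 < eps ->
  kappa * (H + 4 * sigma) = 2 * h - 2 * sigma -> 0 <= kappa <= 2 ->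
  (forall a b, (B0 <= b)%N -> (a <= b)%N -> psi b - psi a <= 2 * (b%:R - a%:R) + eps * b%:R) ->
  2 <= eps * B0%:R -> expR (h + sigma) <= sigma * B0%:R -> sigma <= 1 ->
  (0 < N)%N -> ln N%:R + h <= ln N'%:R -> ln N'%:R <= ln N%:R + h + sigma ->
  (0 < n <= n')%N -> ln n'%:R - ln n%:R <= H + 3 * sigma ->
  (n' * B0 <= N')%N -> ~~ sparse eps N N' n' ->
  kappa * (ln (N %/ n).+1%:R - ln (N %/ n').+1%:R) - 3 * eps * expR (h + sigma) <=
  logpsi (N %/ n) - logpsi (N %/ n').
Proof.
move=> /andP[h0 hH] s0 e0 kE /andP[k0 k2] HB eB sB s1 N0 lN lN' /andP[n0 nn'] ln' nB.
rewrite /sparse -leNgt => good.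
have n'0 : (0 < n')%N := leq_trans n0 nn'.
have NR : 0 < N%:R :> R by rewrite ltr0n.
have N'0 : (0 < N')%N.
  case: (posnP N') => // N'E; move: lN; rewrite N'E (@ln0 _ 0) //.
  by have := lnnat_ge0 R N; lra.
have N'R : 0 < N'%:R :> R by rewrite ltr0n.
have NN' : (N <= N')%N.
  by rewrite -(ler_nat R) -ler_ln ?posrE //; lra.
have n'R : 0 < n'%:R :> R by rewrite ltr0n.
have nR : 0 < n%:R :> R by rewrite ltr0n.
have rat : N'%:R <= N%:R * expR (h + sigma) by apply: ratio_le_expR => //; rewrite addrA.
have eR := expR_gt0 (h + sigma).
set a := (N %/ n')%N; set b := (N' %/ n')%N; set c := (N %/ n)%N.
have ab : (a <= b)%N by apply: leq_div2r.
have ac : (a <= c)%N by apply: leq_div2l.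
have B0b : (B0 <= b)%N by rewrite leq_divRL // mulnC.
have [b1 b2] := divn_ratio_bounds N' n'0.
have [a1 a2] := divn_ratio_bounds N n'0.
have q0 : B0%:R <= N'%:R / n'%:R :> R by apply: le_trans b1; rewrite ler_nat.
have nN : n'%:R <= sigma * N%:R.
  have h1 : n'%:R * B0%:R <= N%:R * expR (h + sigma) by apply: le_trans rat; rewrite -natrM ler_nat.
  have h2 : N%:R * expR (h + sigma) <= N%:R * (sigma * B0%:R) by rewrite ler_pM2l.
  have B0R : 0 < B0%:R :> R.
    by rewrite -(pmulr_rgt0 _ s0); apply: lt_le_trans sB.
  rewrite -(ler_pM2r B0R); lra.
have n'N : (n' <= N)%N.
  by rewrite -(ler_nat R); apply: le_trans nN _; rewrite ler_piMl // ltW.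
have n'Ns : n'%:R / N%:R <= sigma by rewrite ler_pdivrMr.
have nNs : n%:R / N%:R <= sigma.
  by apply: le_trans n'Ns; rewrite ler_pM2r ?invr_gt0 // ler_nat.
set E := 3 * eps * (N'%:R / n'%:R).
(* The mass of (a, b] is nearly maximal and that of (s, b] cannot exceed density 2, so each initial
   piece (a, s] is nearly full too. *)
have dens s : (a <= s <= b)%N -> 2 * (s%:R - a%:R) - E <= psi s - psi a.
  move=> /andP[as_ sb]; have := HB s b B0b sb.
  have e1 : eps * b%:R <= eps * (N'%:R / n'%:R) by rewrite ler_pM2l.
  have e2 : eps * B0%:R <= eps * (N'%:R / n'%:R) by rewrite ler_pM2l.
  move: good; rewrite (_ : _ / _ = 2 * (N'%:R / n'%:R) - 2 * (N%:R / n'%:R) -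
     eps * (N'%:R / n'%:R)); last by ring.
  rewrite -natr1 in a2; rewrite -/a -/b /E in b1 a2 *.
  by move: (N'%:R / n'%:R) (N%:R / n'%:R) b1 a2 e1 e2 q0 => y x *; lra.
have Ea : E / a.+1%:R <= 3 * eps * expR (h + sigma).
  rewrite ler_pdivrMr ?ltr0n // /E -[X in _ <= X]mulrA ler_pM2l ?mulr_gt0 //.
  apply: (@le_trans _ _ (expR (h + sigma) * (N%:R / n'%:R))); last by rewrite ler_pM2l.
  by rewrite mulrA ler_pM2r ?invr_gt0 // mulrC.
have [c1 c2] := @ln_divn_bounds N n ltac:(by rewrite n0 (leq_trans nn')).
have [d1 d2] := @ln_divn_bounds N n' ltac:(by rewrite n'0).
have [f1 _] := @ln_divn_bounds N' n' ltac:(by rewrite n'0 (leq_trans n'N)).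
rewrite -/a -/b -/c in c1 c2 d1 d2 f1.
have [cb|bc] := leqP c b.
  have := logpsi_heavy ac (fun s sac => dens s ltac:(case/andP: sac => -> sc; exact: leq_trans sc cb)).
  have D0 : 0 <= ln c.+1%:R - ln a.+1%:R :> R by rewrite subr_ge0 ler_lnnat.
  have := ler_wpM2r D0 k2.
  by move: (E / _) Ea => q Ea; lra.
have := logpsi_heavy ab dens; have := logpsi_le R (ltnW bc).
have : kappa * (ln c.+1%:R - ln a.+1%:R) <= kappa * (H + 4 * sigma).
  by apply: ler_wpM2l => //; lra.
rewrite kE; move: (E / _) Ea => q Ea; lra.
Qed.

Lemma density_step h H : 0 < h <= H -> H < 2 * h ->
  positive_density H -> positive_density h.
Proof.
move=> /andP[h0 hH] H2 [delta [N0 [d0 N00 dens]]].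
(* All rounding errors are multiples of [sigma]; this choice keeps [2 * h - 2 * sigma] above
   [H + 4 * sigma], so that [kappa > 1]. *)
pose sigma := Num.min ((2 * h - H) / 10) 1.
have s0 : 0 < sigma by rewrite lt_min ltr01 andbT divr_gt0 // subr_gt0.
have s1 : sigma <= 1 by rewrite ge_min lexx orbT.
have sH : 10 * sigma <= 2 * h - H.
  by rewrite mulrC -ler_pdivlMr // ge_min lexx.
clearbody sigma.
pose kappa := (2 * h - 2 * sigma) / (H + 4 * sigma).
have den : 0 < H + 4 * sigma by lra.
have kE : kappa * (H + 4 * sigma) = 2 * h - 2 * sigma by rewrite divfK // gt_eqF.
have k1 : 1 < kappa by rewrite ltr_pdivlMr //; lra.
have k2 : kappa <= 2 by rewrite ler_pdivrMr //; lra.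
clearbody kappa.
(* The gain over density 1 after [k] steps must beat 18: twice 8 from Mertens, 1 for an off-by-one
   in a logarithm, and 1 for the errors of all steps, which [eps] is chosen to make exactly 1. *)
have [k kR k0] : exists2 k, 18 < (kappa - 1) * (k%:R * sigma - 1) & (0 < k)%N.
  pose k := (Num.bound (18 / (kappa - 1) / sigma + 1 / sigma)).+1; exists k => //.
  have k1' : 0 < kappa - 1 by lra.
  have : 18 / (kappa - 1) / sigma + 1 / sigma < k%:R.
    have y0 : 0 <= 18 / (kappa - 1) / sigma + 1 / sigma.
      by apply: addr_ge0; apply: ltW; rewrite !divr_gt0.
    apply: (lt_trans (archi_boundP y0)); rewrite ltr_nat.
    exact: ltnSn.
  rewrite -(ltr_pM2r s0) mulrDl !divfK ?gt_eqF // => kk.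
  rewrite mulrC -ltr_pdivrMr //; lra.
have kpos : 0 < k%:R :> R by rewrite ltr0n.
have eR := expR_gt0 (h + sigma).
have [eps e0 err] : exists2 eps, 0 < eps & k%:R * (3 * eps * expR (h + sigma)) = 1.
  exists (3 * expR (h + sigma) * k%:R)^-1.
    by rewrite invr_gt0 mulr_gt0 // mulr_gt0.
  by move: (expR _) eR => x x0; field; rewrite !gt_eqF.
have [B1 [B10 HB1]] := psi_upper_density e0.
have [B0 [B10B eB sB B0p]] : exists B0, [/\ (B1 <= B0)%N, 2 <= eps * B0%:R,
    expR (h + sigma) <= sigma * B0%:R & (0 < B0)%N].
  exists (B1 + Num.bound (2 / eps) + Num.bound (expR (h + sigma) / sigma))%N; split.
  - by rewrite -addnA leq_addr.
  - rewrite mulrC -ler_pdivrMr //; apply: (@le_trans _ _ (Num.bound (2 / eps))%:R).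
      by apply/ltW/archi_boundP; rewrite divr_ge0 // ltW.
    by rewrite ler_nat addnAC leq_addl.
  - rewrite mulrC -ler_pdivrMr //.
    apply: (@le_trans _ _ (Num.bound (expR (h + sigma) / sigma))%:R).
      by apply/ltW/archi_boundP; rewrite divr_ge0 // ltW.
    by rewrite ler_nat leq_addl.
  - by rewrite -addnA ltn_addr.
(* With this [M], all [k] steps of the chain fit into one block from [z] to [z * M]. *)
have [M M1 lM] : exists2 M, (1 < M)%N & k%:R * (H + 3 * sigma) <= ln M%:R.
  have [M0 HM0] := ln_nat_unbounded (k%:R * (H + 3 * sigma)).
  by exists M0.+2 => //; apply: HM0; rewrite ltnW.
have M0 : (0 < M)%N := ltnW M1.
have [A1 HA1] := nat_log_approx s0.
(* A lower bound for the sum of [mangoldt n / n] over an interval of logarithmic length about [H]; a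
   block with less sparse mass has a non-sparse [n] in each such interval. *)
pose tau := delta * expR (- (H + sigma)).
have tau0 : 0 < tau by rewrite mulr_gt0 // expR_gt0.
have [eta [N1 [eta0 HN1]]] := @sparse_block R eps tau M (N0 + A1)%N B0 e0 tau0 M1 ltac:(by rewrite ltn_addr).
exists eta, (N1 + (N0 + A1)).+1; split=> // N N'' NN0 lN''.
rewrite leNgt; apply/negP => gap.
have A1N : (A1 <= N)%N by clear -NN0; lia.
have N1N : (N1 <= N)%N by clear -NN0; lia.
have N0p : (0 < N)%N by clear -NN0; lia.
(* The least admissible end point [N'] replaces [N'']: its mass is no larger, and its ratio to [N]
   is controlled from above. *)
have [N' [lN lN' NN' N'min]] := HA1 N h A1N (ltW h0).
have {}gap : psi N' - psi N <= eta * N'%:R.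
  have N''0 : (0 < N'')%N.
    case: (posnP N'') => // N'E; move: lN''; rewrite N'E (@ln0 _ 0) //.
    by have := lnnat_ge0 R N; lra.
  apply: (@le_trans _ _ (psi N'' - psi N)); first by rewrite lerB // psi_le // N'min.
  by apply: ltW; apply: lt_le_trans gap _; rewrite ler_pM2l // ler_nat.
have N'0 : (0 < N')%N := leq_trans N0p NN'.
have [z [Az zM bad]] := HN1 N N' ltac:(by rewrite N0p) (leq_trans N1N NN') gap.
have N0z : (N0 <= z)%N := leq_trans (leq_addr _ _) Az.
have A1z : (A1 <= z)%N := leq_trans (leq_addl _ _) Az.
have z0 : (0 < z)%N := leq_trans N00 N0z.
have good y y' : (z <= y)%N -> ln y%:R + H <= ln y'%:R -> ln y'%:R <= ln y%:R + H + sigma ->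
    (y <= y')%N -> (y' <= z * M)%N -> exists2 n, (y < n <= y')%N & ~~ sparse eps N N' n.
  move=> zy l1 l2 yy' y'M; apply: contrapT => nex; move: bad; apply/negP; rewrite -leNgt.
  have y0 : (0 < y)%N := leq_trans z0 zy.
  have y'0 : (0 < y')%N := leq_trans y0 yy'.
  have y'R : 0 < y'%:R :> R by rewrite ltr0n.
  have yexp : y'%:R <= y%:R * expR (H + sigma) by apply: ratio_le_expR; rewrite ?addrA.
  apply: (@le_trans _ _ (\sum_(y.+1 <= n < y'.+1) mangoldt n / n%:R)).
    apply: (@le_trans _ _ ((psi y' - psi y) / y'%:R)).
      rewrite ler_pdivlMr //; apply: (@le_trans _ _ (delta * y%:R)).
        by rewrite /tau expRN -mulrA ler_pM2l // mulrC ler_pdivrMr ?expR_gt0.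
      by apply: dens => //; apply: leq_trans zy.
    rewrite psiB // mulr_suml !big_nat; apply: ler_sum => n /andP[yn ny'].
    by rewrite ler_wpM2l ?mangoldt_ge0 // lef_pV2 ?posrE ?ltr0n ?ler_nat // (leq_trans y0 (ltnW yn)).
  rewrite [X in _ <= X](@big_cat_nat _ _ _ y.+1) ?ltnS //=; last exact: leq_trans y'M.
  rewrite [X in _ <= _ + X](@big_cat_nat _ _ _ y'.+1) ?ltnS //=.
  have nn (P : pred nat) s : 0 <= \sum_(n <- s | P n) mangoldt n / n%:R.
    by apply: sumr_ge0 => n _; rewrite mulr_ge0 ?mangoldt_ge0 ?invr_ge0.
  apply: (@le_trans _ _ (\sum_(y.+1 <= i < y'.+1 | sparse eps N N' i) mangoldt i / i%:R)).
    rewrite [X in _ <= X]big_mkcond !big_nat; apply: ler_sum => n yn.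
    by case: ifP => // /negbT sn; case: nex; exists n.
  have := nn (sparse eps N N') (index_iota z.+1 y.+1).
  have := nn (sparse eps N N') (index_iota y'.+1 (z * M).+1); lra.
(* Each step first moves up by [sigma], to guarantee progress, and then to a non-sparse [n'] within
   [H]; with rounding it covers at most [H + 3 * sigma]. *)
have chain i : (i <= k)%N -> exists n, [/\ (z <= n)%N, (n <= z * M)%N,
    i%:R * sigma <= ln n%:R - ln z%:R, ln n%:R - ln z%:R <= i%:R * (H + 3 * sigma) &
    kappa * (ln (N %/ z).+1%:R - ln (N %/ n).+1%:R) - i%:R * (3 * eps * expR (h + sigma)) <=
    logpsi (N %/ z) - logpsi (N %/ n)].
  elim: i => [_|i IH ik].
    by exists z; rewrite !subrr !mul0r mulr0 subrr leq_pmulr.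
  have [n [zn nM n1 n2 n3]] := IH (ltnW ik).
  have n0 : (0 < n)%N := leq_trans z0 zn.
  have [y [y1 y2 ny _]] := HA1 n sigma (leq_trans A1z zn) (ltW s0).
  have [y' [y'1 y'2 yy' _]] := HA1 y H (leq_trans (leq_trans A1z zn) ny) (le_trans (ltW h0) hH).
  have y0 : (0 < y)%N := leq_trans n0 ny.
  have y'0 : (0 < y')%N := leq_trans y0 yy'.
  have ik' : (i.+1)%:R * (H + 3 * sigma) <= k%:R * (H + 3 * sigma).
    by rewrite ler_wpM2r ?ler_nat //; lra.
  have iS : i.+1%:R = i%:R + 1 :> R by rewrite -natr1.
  have y'M : (y' <= z * M)%N.
    rewrite -(ler_nat R) -ler_ln ?posrE ?ltr0n ?muln_gt0 ?z0 //.
    rewrite natrM lnM ?posrE ?ltr0n //; rewrite iS in ik'; lra.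
  have [n' /andP[yn' n'y'] n'good] := good y y' (leq_trans zn ny) y'1 y'2 yy' y'M.
  have a1 : ln y%:R <= ln n'%:R :> R by apply: ler_lnnat => //; apply: ltnW.
  have a2 : ln n'%:R <= ln y'%:R :> R by apply: ler_lnnat => //; apply: leq_trans yn'.
  have nn' : (n <= n')%N := leq_trans ny (ltnW yn').
  have n'M := leq_trans n'y' y'M.
  exists n'; rewrite iS; split; [exact: leq_trans nn'|exact: n'M|lra|lra|].
  have n'B : (n' * B0 <= N')%N.
    by apply: leq_trans zM; rewrite leq_mul2r n'M orbT.
  have := @heavy_step h H sigma eps kappa B0 N N' n n' ltac:(by rewrite h0) s0 e0 kE
    ltac:(by apply/andP; split; lra) (fun a b Bb => HB1 a b (leq_trans B10B Bb))
    eB sB s1 N0p lN lN' ltac:(by rewrite n0) ltac:(lra) n'B n'good.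
  lra.
have [n [zn nM n1 n2 n3]] := chain k (leqnn k).
have NR : 0 < N%:R :> R by rewrite ltr0n.
have nN : n%:R <= sigma * N%:R.
  have rat : N'%:R <= N%:R * expR (h + sigma) by apply: ratio_le_expR; rewrite ?addrA.
  have h1 : n%:R * B0%:R <= N%:R * expR (h + sigma).
    apply: le_trans rat; rewrite -natrM ler_nat; apply: leq_trans zM.
    by rewrite leq_mul2r nM orbT.
  have h2 : N%:R * expR (h + sigma) <= N%:R * (sigma * B0%:R) by rewrite ler_pM2l.
  have B0R : 0 < B0%:R :> R by rewrite ltr0n.
  rewrite -(ler_pM2r B0R); lra.
have nN' : (n <= N)%N.
  by rewrite -(ler_nat R); apply: le_trans nN _; rewrite ler_piMl // ltW.
have n0 : (0 < n)%N := leq_trans z0 zn.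
have nNs : n%:R / N%:R <= 1 :> R by rewrite ler_pdivrMr // mul1r ler_nat.
have [c1 c2] := @ln_divn_bounds N n ltac:(by rewrite n0).
have [d1 d2] := @ln_divn_bounds N z ltac:(by rewrite z0 (leq_trans zn)).
have q1 : (0 < N %/ n)%N by rewrite divn_gt0.
have q2 : (0 < N %/ z)%N by rewrite divn_gt0 // (leq_trans zn).
have /ler_normlP[_ m1] := mertens R q2.
have /ler_normlP[m2 _] := mertens R q1.
have /andP[_ l1] := @lnS_sub R _ q1.
have l1' : (N %/ n)%:R^-1 <= 1 :> R by rewrite invf_le1 ?ler1n ?ltr0n.
have l2 : ln (N %/ z)%:R <= ln (N %/ z).+1%:R :> R by apply: ler_lnnat.
move: n3; rewrite err => n3.
set X := ln (N %/ z).+1%:R - ln (N %/ n).+1%:R in n3.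
have XE : X = ln (N %/ z).+1%:R - ln (N %/ n).+1%:R by [].
clearbody X.
have X1 : k%:R * sigma - 1 <= X by rewrite XE; lra.
have k1' : 0 <= kappa - 1 by lra.
have := ler_wpM2l k1' X1.
move: (_^-1) l1 l1' => q l1 l1'; lra.
Qed.

End Step.

(** * From admissible lengths to primes between [N] and [(1 + eps) * N] *)

Section PrimeGaps.
Variable R : realType.
Implicit Types (n m d p N M : nat) (eps h : R).
Local Notation psi := (@psi R).
Local Notation logpsi := (@logpsi R).
Local Notation mangoldt := (@mangoldt R).

Lemma ltn_ln_add N N' (h : R) : (0 < N)%N -> 0 < h -> ln N%:R + h <= ln N'%:R -> (N < N')%N.
Proof.
move=> N0 h0 H; have N'0 : (0 < N')%N.
  case: (posnP N') => // N'E; move: H; rewrite N'E (@ln0 _ 0) //.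
  by have := lnnat_ge0 R N; lra.
by rewrite -(ltr_nat R) -ltr_ln ?posrE ?ltr0n //; lra.
Qed.

(** Mertens' estimate with error 8 at each end leaves logarithmic mass at least 17 - 16 = 1. *)
Lemma positive_density17 : positive_density (17 : R).
Proof.
exists 1, 1%N; split=> // N N' N0 lN; rewrite mul1r.
have NN' : (N < N')%N by apply: ltn_ln_add lN => //; rewrite ltr0n.
have NR : 0 < N%:R :> R by rewrite ltr0n.
have /ler_normlP[m1 _] := mertens R (ltn_trans N0 NN').
have /ler_normlP[_ m2] := mertens R N0.
have : logpsi N' - logpsi N <= (psi N' - psi N) / N%:R.
  rewrite logpsiB ?psiB ?(ltnW NN') // mulr_suml !big_nat; apply: ler_sum => n /andP[Nn _].
  rewrite ler_wpM2l ?mangoldt_ge0 // lef_pV2 ?posrE ?ltr0n ?ler_nat ?(ltnW Nn) //.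
  exact: leq_ltn_trans (leq0n N) Nn.
rewrite ler_pdivlMr // => H; have : 1 * N%:R <= (logpsi N' - logpsi N) * N%:R.
  by rewrite ler_wpM2r //; lra.
lra.
Qed.

Lemma positive_density_le (h h' : R) : h <= h' -> positive_density h -> positive_density h'.
Proof.
move=> hh' [delta [N0 [d0 N00 H]]]; exists delta, N0; split=> // N N' NN lN.
by apply: H => //; lra.
Qed.

(** Iterate [density_step] from 17 with ratio 2/3, which exceeds the required 1/2. *)
Lemma positive_densityT (h : R) : 0 < h -> positive_density h.
Proof.
move=> h0.
have P k : positive_density (17 * (2 / 3) ^+ k : R).
  elim: k => [|k IH]; first by rewrite expr0 mulr1; apply: positive_density17.
  have x0 : 0 < (2 / 3) ^+ k :> R by rewrite exprn_gt0 //; lra.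
  by apply: density_step IH; rewrite exprS; [apply/andP; split|]; lra.
have B k : (2 / 3) ^+ k <= 2 / (k%:R + 2) :> R.
  elim: k => [|k IH]; first by rewrite expr0 add0r divff ?pnatr_eq0.
  have k0 : 0 <= k%:R :> R by [].
  rewrite exprS -[k.+1%:R]natr1 ler_pdivlMr; last by lra.
  move: IH; rewrite ler_pdivlMr; last by lra.
  have : 0 <= (2 / 3) ^+ k :> R by rewrite exprn_ge0 //; lra.
  move: ((2 / 3) ^+ k) => x x0; have : 0 <= x * k%:R by rewrite mulr_ge0.
  lra.
pose k := Num.bound (34 / h).
apply: (positive_density_le _ (P k)).
have k0 : 34 / h < k%:R by apply: archi_boundP; rewrite divr_ge0 // ltW.
have := B k; rewrite ltr_pdivrMr // in k0.
rewrite ler_pdivlMr; last by rewrite ltr_wpDl.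
have : 0 <= (2 / 3) ^+ k :> R by rewrite exprn_ge0 //; lra.
move: ((2 / 3) ^+ k) => x x0 xk; rewrite leNgt; apply/negP => hx.
have : h * k%:R <= 17 * x * k%:R by rewrite ler_wpM2r // ltW.
lra.
Qed.

(** Only powers [p ^ k] with [k >= 2] contribute, so [p < s]; as [N' <= 2 * N], each [p] has at most
    one power in the range. *)
Lemma sum_mangoldt_no_prime N N' s : (N' <= 2 * N)%N -> (N' < s ^ 2)%N ->
  (forall p, (N < p <= N')%N -> ~~ prime p) ->
  \sum_(N.+1 <= n < N'.+1) mangoldt n <= s%:R * ln N'%:R.
Proof.
move=> N'2 N's np.
pose A := [seq n <- index_iota N.+1 N'.+1 | mangoldt n != 0].
have AP n : n \in A -> exists2 p, prime p & exists2 k, (1 < k)%N &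
    [/\ n = (p ^ k)%N, (N < n)%N & (n <= N')%N].
  rewrite mem_filter mem_index_iota ltnS => /andP[/mangoldt_neq0[p pp [k k0 nE]] /andP[Nn nN']].
  exists p => //; exists k => //; case: k k0 nE => [|[|k]] // _ nE.
  by have := np n; rewrite Nn nN' nE expn1 pp => /(_ isT).
have sA : (size A <= s)%N.
  rewrite -(size_map pdiv) -[s](size_iota 0); apply: uniq_leq_size.
    rewrite map_inj_in_uniq ?filter_uniq ?iota_uniq // => n m.
    move=> /AP[p pp [[//|k] k1 [nE Nn nN']]] /AP[q qp [[//|j] j1 [mE Nm mN']]].
    rewrite nE mE !pdiv_pfactor // => pq; rewrite -{q}pq in qp mE *; rewrite nE mE in Nn nN' Nm mN' *.
    have p1 := prime_gt1 pp.
    have lem a b : (a < b)%N -> (2 * p ^ a <= p ^ b)%N.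
      by move=> ab; apply: (leq_trans (n := (p ^ a.+1)%N)); rewrite ?leq_exp2l // expnS leq_mul2r p1 orbT.
    case: (ltngtP k j) => [kj|jk|->] //.
      by have := lem k.+1 j.+1 kj; lia.
    by have := lem j.+1 k.+1 jk; lia.
  move=> _ /mapP[n /AP[p pp [[//|k] k1 [nE Nn nN']]] ->].
  rewrite mem_iota add0n leq0n nE pdiv_pfactor //=.
  rewrite -(ltn_exp2r _ _ (isT : (0 < 2)%N)); apply: leq_ltn_trans N's.
  by apply: leq_trans nN'; rewrite nE leq_exp2l // prime_gt1.
apply: (@le_trans _ _ ((size A)%:R * ln N'%:R)); last by rewrite ler_wpM2r ?lnnat_ge0 // ler_nat.
rewrite (bigID (fun n => mangoldt n != 0)) /= [X in _ + X]big1 ?addr0; last by move=> i /negPn/eqP.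
rewrite -big_filter -/A mulr_natl -(count_predT A) -iter_addr_0 -big_const_seq !big_seq.
apply: ler_sum => n /AP[p pp [k k1 [nE Nn nN']]].
by apply: le_trans (mangoldt_le_ln _ _) _; apply: ler_lnnat => //; apply: leq_ltn_trans Nn.
Qed.

Lemma prime_in_short_interval eps : 0 < eps -> exists N0, forall N, (N0 <= N)%N ->
  exists p, [/\ prime p, (N < p)%N & p%:R <= (1 + eps) * N%:R].
Proof.
wlog e1 : eps / eps <= 1 => [W e0|e0].
  have [e1|e1] := leP eps 1; first exact: W.
  have [//||N0 H] := W 1; first by [].
  exists N0 => N /H[p [pp Np pN]]; exists p; split=> //.
  by apply: le_trans pN _; rewrite ler_wpM2r //; lra.
have l0 : 0 < ln (1 + eps) by rewrite ln_gt0 //; lra.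
(* The other half of [ln (1 + eps)] pays for rounding [N'] to an integer. *)
pose h := ln (1 + eps) / 2.
have h0 : 0 < h by rewrite divr_gt0.
have [delta [N1 [d0 N10 H]]] := positive_densityT h0.
have [A HA] := nat_log_approx h0.
have [N2 HN2] := ln_nat_unbounded (64 / delta + 1).
exists (N1 + A + N2)%N => N N0N.
have N1N : (N1 <= N)%N by apply: leq_trans N0N; rewrite -addnA leq_addr.
have AN : (A <= N)%N by apply: leq_trans N0N; rewrite addnAC leq_addl.
have N2N : (N2 <= N)%N by apply: leq_trans N0N; rewrite leq_addl.
have Np : (0 < N)%N := leq_trans N10 N1N.
have [N' [lN lN' NN' _]] := HA N h AN (ltW h0).
have N'p : (0 < N')%N := leq_trans Np NN'.
have N'R : 0 < N'%:R :> R by rewrite ltr0n.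
have NR : 0 < N%:R :> R by rewrite ltr0n.
have N'e : N'%:R <= (1 + eps) * N%:R.
  rewrite -ler_ln ?posrE ?mulr_gt0 //; last by lra.
  by rewrite lnM ?posrE //; [rewrite /h in lN'; lra|lra].
apply: contrapT => nex.
have np p : (N < p <= N')%N -> ~~ prime p.
  move=> /andP[Nltp pN']; apply/negP => pp; apply: nex; exists p; split=> //.
  by apply: le_trans N'e; rewrite ler_nat.
have N'2 : (N' <= 2 * N)%N.
  rewrite -(ler_nat R) natrM; apply: le_trans N'e _; rewrite ler_wpM2r //; lra.
have [s sN' smin] : exists2 s, (N' < s ^ 2)%N & (s.-1 ^ 2 <= N')%N.
  have ex : exists s, (N' < s ^ 2)%N by exists N'.+1; rewrite -mulnn; exact: leq_pmulr.
  case: (ex_minnP ex) => -[|s] // sN' smin; exists s.+1 => //=.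
  by rewrite leqNgt; apply/negP => /smin; rewrite ltnn.
have := sum_mangoldt_no_prime N'2 sN' np; rewrite -psiB //; have := H N N' N1N lN.
(* In terms of the fourth root [r], the mass is at least [delta * r ^ 4 / 2] and, without primes, at
   most [8 * r ^ 3]; hence [delta * r <= 16], contradicting [ln N <= 4 * r] and the choice of
   [N2]. *)
set r := Num.sqrt (Num.sqrt N'%:R : R).
have x1 : 1 <= N'%:R :> R by rewrite ler1n.
have r1 : 1 <= r by rewrite !ge1_sqrtr.
have sE : Num.sqrt N'%:R = r ^+ 2 by rewrite sqr_sqrtr // sqrtr_ge0.
have xE : N'%:R = r ^+ 4 by rewrite (exprM r 2 2) -sE sqr_sqrtr.
have lr : ln N'%:R <= 4 * r.
  by rewrite xE lnXn; [rewrite -mulr_natl; have := @ln_sublinear R r; lra|lra].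
have s2 : s%:R <= 2 * r ^+ 2.
  have : s.-1%:R <= r ^+ 2.
    rewrite -ler_sqr ?nnegrE ?exprn_ge0 //; last by lra.
    by rewrite -exprM -natrX -xE ler_nat.
  have : s%:R <= s.-1%:R + 1 :> R by rewrite natr1 ler_nat leqSpred.
  have : 1 <= r ^+ 2 by rewrite exprn_ege1.
  by lra.
have sl : s%:R * ln N'%:R <= 2 * r ^+ 2 * (4 * r) by rewrite ler_pM ?lnnat_ge0.
move=> H1 H2.
have N'2R : r ^+ 4 <= 2 * N%:R by rewrite -xE -natrM ler_nat.
have D1 := ler_wpM2l (ltW d0) N'2R.
have dr : delta * r <= 16.
  have r3 : 0 < r ^+ 3 by rewrite exprn_gt0 //; lra.
  rewrite -(ler_pM2r r3) -mulrA -exprS.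
  have E : 2 * r ^+ 2 * (4 * r) = 8 * r ^+ 3 by ring.
  lra.
have lnN := HN2 N N2N.
have : 64 / delta + 1 <= 4 * r.
  by apply: le_trans lnN _; apply: le_trans lr; apply: ler_lnnat.
move=> /(ler_wpM2l (ltW d0)); rewrite mulrDr mulrCA divff ?gt_eqF //; lra.
Qed.

End PrimeGaps.

(** * Asymptotics *)

From mathcomp Require Import all_classical all_reals all_analysis.
Import Order.TTheory GRing.Theory Num.Theory.
Import numFieldNormedType.Exports.
Local Open Scope classical_set_scope.
Local Open Scope ring_scope.

Section Asymptotics.
Variable R : realType.
Local Notation ex n := (ex_ind n (cycle_graph 5) (complete_bipartite 2 2)).

Lemma sqrt_nat_unbounded (x : R) : exists N0, forall n, (N0 <= n)%N -> x <= Num.sqrt n%:R.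
Proof.
exists (Num.bound (x ^+ 2)) => n nN.
apply: le_trans (ler_norm x) _; rewrite -sqrtr_sqr ler_wsqrtr //.
apply: (@le_trans _ _ (Num.bound (x ^+ 2))%:R); last by rewrite ler_nat.
by apply/ltW/archi_boundP/sqr_ge0.
Qed.

Lemma ex_ind_asymptotic_upper (eta : R) : 0 < eta -> exists N0, forall n, (N0 <= n)%N ->
  (ex n)%:R <= (1 + eta) * (n%:R * Num.sqrt n%:R / 2) :> R.
Proof.
move=> e0.
pose D := (Num.bound (2 / eta)).+1.
have D0 : (0 < D)%N by [].
have DR : 0 < D%:R :> R by rewrite ltr0n.
have De : 2 <= eta * D%:R.
  rewrite mulrC -ler_pdivrMr //; apply: (@le_trans _ _ (Num.bound (2 / eta))%:R).
    by apply/ltW/archi_boundP; rewrite divr_ge0 // ltW.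
  by rewrite ler_nat.
have [N0 HN0] := sqrt_nat_unbounded (8 * D%:R / eta + 8 * (1 + eta) / eta + 4 + 1).
exists N0 => n nN; have [S] := ex_ind_upper n D0.
rewrite -!(ler_nat R) !(natrM, natrD, natrX).
set x := (ex n)%:R; set s := S%:R; set q := Num.sqrt n%:R.
have nE : n%:R = q ^+ 2 by rewrite sqr_sqrtr.
rewrite nE => H1 H2.
have qN := HN0 n nN; rewrite -/q in qN.
clearbody D; clear HN0.
have a1 : 0 <= D%:R / eta :> R by rewrite divr_ge0 // ltW.
have a2 : 0 <= (1 + eta) / eta by rewrite divr_ge0 //; lra.
have q1 : 8 * D%:R <= eta * q.
  rewrite [eta * q]mulrC -ler_pdivrMr //; lra.
have q2 : 8 * (1 + eta) <= eta * q.
  rewrite [eta * q]mulrC -ler_pdivrMr //; lra.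
have q3 : 4 <= q by lra.
have q0 : 0 < q by lra.
have s0 : 0 <= s by [].
have w0 : 0 < q ^+ 3 by rewrite exprn_gt0.
have H3 : s ^+ 2 <= (1 + eta) * (q ^+ 3) ^+ 2 + 4 * q ^+ 2 * s.
  rewrite -(ler_pM2l DR); apply: le_trans H2 _.
  have : 2 * (q ^+ 3) ^+ 2 <= eta * D%:R * (q ^+ 3) ^+ 2 by rewrite ler_wpM2r // exprn_ge0 // ltW.
  rewrite -!exprM; lra.
(* The last quarter of [eta] pays for the [2 * D * n] lost to deleted vertices. *)
suff sw : s <= (1 + 3 / 4 * eta) * q ^+ 3.
  have : 8 * D%:R * q ^+ 2 <= eta * q * q ^+ 2 by rewrite ler_wpM2r // exprn_ge0 // ltW.
  rewrite (_ : eta * q * q ^+ 2 = eta * q ^+ 3); last by ring.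
  by rewrite -exprSr => H4; lra.
rewrite leNgt; apply/negP => sw; set w := q ^+ 3 in H3 sw w0 *.
have qw : 4 * q ^+ 2 <= w by rewrite /w (exprS q 2) ler_wpM2r // exprn_ge0 // ltW.
have k1 : 0 <= eta * w by rewrite mulr_ge0 ?ltW.
have : (1 + 3 / 4 * eta) * w * ((1 + 3 / 4 * eta) * w - 4 * q ^+ 2) <= s * (s - 4 * q ^+ 2).
  by rewrite ler_pM //; lra.
have k2 : 8 * (1 + eta) * (q ^+ 2 * w) <= eta * q * (q ^+ 2 * w).
  by rewrite ler_wpM2r // mulr_ge0 ?exprn_ge0 // ltW.
have k3 : eta * q * (q ^+ 2 * w) = eta * (w * w) by rewrite /w; ring.
have k4 : 0 < eta * (w * w) by rewrite !mulr_gt0.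
have k5 : 0 < eta * (eta * (w * w)) by rewrite mulr_gt0.
have k6 : 0 <= eta * (q ^+ 2 * w) by rewrite !mulr_ge0 ?exprn_ge0 // ltW.
have k7 : 0 <= q ^+ 2 * w by rewrite !mulr_ge0 ?exprn_ge0 // ltW.
rewrite k3 in k2; rewrite expr2 [w ^+ 2]expr2 in H3.
move: (q ^+ 2) qw k2 k6 k7 H3 => y *; lra.
Qed.

(** Use a prime between [t / (1 + eps)] and [t], where [3 * t ^ 2 = n]; the choice [eps = eta / 3]
    works because [(1 - 3 * eps) * (1 + eps) ^ 3 <= 1]. *)
Lemma ex_ind_asymptotic_lower (eta : R) : 0 < eta -> exists N0, forall n, (N0 <= n)%N ->
  (1 - eta) * (2 * Num.sqrt (n%:R / 3) ^+ 3) <= (ex n)%:R :> R.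
Proof.
move=> e0; pose eps := eta / 3.
have eps0 : 0 < eps by rewrite divr_gt0.
have [N1 HN1] := prime_in_short_interval eps0.
have [N0 HN0] := sqrt_nat_unbounded (Num.sqrt 3 * ((1 + eps) * N1.+1%:R)).
exists N0 => n /HN0; set t := Num.sqrt (n%:R / 3).
have -> : Num.sqrt n%:R = Num.sqrt 3 * t.
  by rewrite -sqrtrM // mulrC divfK // pnatr_eq0.
rewrite ler_pM2l ?sqrtr_gt0 // => tN.
have t0 : 0 <= t by apply: sqrtr_ge0.
pose y := t / (1 + eps).
have e1 : 0 < 1 + eps by lra.
have y0 : 0 <= y by rewrite divr_ge0 // ltW.
have yN : N1.+1%:R <= y by rewrite ler_pdivlMr // mulrC.
(* Since [N] is the integer part of [y], a prime [p > N] satisfies [p >= N + 1 > y]. *)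
have /andP[Ny yN'] := truncn_itv y0; set N := Num.truncn y in Ny yN'.
have N1N : (N1 <= N)%N.
  by rewrite -ltnS -(ltr_nat R); apply: le_lt_trans yN'; apply: le_trans yN; rewrite ler_nat.
have [p [pp Np pN]] := HN1 N N1N.
have pt : p%:R <= t.
  by apply: le_trans pN _; rewrite mulrC -ler_pdivlMr.
have yp : y <= p%:R by apply: le_trans (ltW yN') _; rewrite ler_nat.
have pn : (3 * p ^ 2 <= n)%N.
  rewrite -(ler_nat R) natrM natrX mulrC -ler_pdivlMr //.
  rewrite -[_ / _]sqr_sqrtr ?divr_ge0 //; apply: lerXn2r => //; rewrite nnegrE //.
apply: le_trans (_ : (2 * p ^ 3)%:R <= _); last by rewrite ler_nat affine_lower_bound.
rewrite natrM natrX mulrCA ler_pM2l //.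
apply: (@le_trans _ _ (y ^+ 3)); last by apply: lerXn2r; rewrite ?nnegrE.
have tE : t = y * (1 + eps) by rewrite divfK // gt_eqF.
have y3 : 0 <= y ^+ 3 by rewrite exprn_ge0.
rewrite tE exprMn mulrCA -[X in _ <= X]mulr1 ler_wpM2l //.
have eE : eta = 3 * eps by rewrite /eps; lra.
rewrite eE; nra.
Qed.

End Asymptotics.

Theorem theorem4 (R : realType) :
  exists e1 e2 : nat -> R,
    [/\ e1 n @[n --> \oo] --> (0 : R),
        e2 n @[n --> \oo] --> (0 : R) &
        \forall n \near \oo,
          2 / (3 * Num.sqrt 3) * n%:R `^ (3 / 2) * (1 + e1 n)
            <= (ex_ind n (cycle_graph 5) (complete_bipartite 2 2))%:R
            <= n%:R `^ (3 / 2) / 2 * (1 + e2 n)].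
Proof.
pose ex n : R := (ex_ind n (cycle_graph 5) (complete_bipartite 2 2))%:R.
pose lo n : R := 2 / (3 * Num.sqrt 3) * n%:R `^ (3 / 2).
pose up n : R := n%:R `^ (3 / 2) / 2.
have pw n : n%:R `^ (3 / 2) = n%:R * Num.sqrt n%:R :> R.
  case: n => [|n]; first by rewrite mul0r powR0 //; lra.
  rewrite (_ : 3 / 2 = 1 + 2^-1); last by lra.
  by rewrite powRD ?powRr1 ?powR12_sqrt // pnatr_eq0 implybT.
have s3 : 0 < Num.sqrt 3 :> R by rewrite sqrtr_gt0.
(* The constant [2 / (3 * sqrt 3)] is that of [2 * p ^ 3] at [p = sqrt (n / 3)]. *)
have loE n : lo n = 2 * Num.sqrt (n%:R / 3) ^+ 3.
  rewrite /lo pw sqrtrM // sqrtrV // exprMn exprSr sqr_sqrtr //.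
  rewrite exprVn exprSr sqr_sqrtr //; field; rewrite gt_eqF //.
have up0 n : (0 < n)%N -> 0 < up n.
  by move=> n0; rewrite /up pw divr_gt0 // mulr_gt0 ?sqrtr_gt0 ?ltr0n.
have lo0 n : (0 < n)%N -> 0 < lo n.
  by move=> n0; rewrite /lo pw mulr_gt0 ?divr_gt0 ?mulr_gt0 ?sqrtr_gt0 ?ltr0n.
(* Truncation at 0 makes the one-sided asymptotic bounds give convergence of the error terms, while
   the required inequalities hold by construction for [n > 0]. *)
exists (fun n => Num.min 0 (ex n / lo n - 1)), (fun n => Num.max 0 (ex n / up n - 1)).
split.
- apply/cvgrPdist_le => eta eta0; have [N0 H] := @ex_ind_asymptotic_lower R eta eta0.
  near=> n.
  have n0 : (0 < n)%N by near: n; exact: nbhs_infty_gt.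
  have Nn : (N0 <= n)%N by near: n; exact: nbhs_infty_ge.
  have := H n Nn; rewrite -loE => h.
  rewrite sub0r normrN ler0_norm ?ge_min ?lexx // lerNl le_min oppr_le0 ltW //=.
  by rewrite lerBrDr addrC ler_pdivlMr ?lo0.
- apply/cvgrPdist_le => eta eta0; have [N0 H] := @ex_ind_asymptotic_upper R eta eta0.
  near=> n.
  have n0 : (0 < n)%N by near: n; exact: nbhs_infty_gt.
  have Nn : (N0 <= n)%N by near: n; exact: nbhs_infty_ge.
  have := H n Nn; rewrite -pw => h.
  rewrite sub0r normrN ger0_norm ?le_max ?lexx // ge_max ltW //=.
  by rewrite lerBlDl ler_pdivrMr ?up0.
- near=> n.
  have n0 : (0 < n)%N by near: n; exact: nbhs_infty_gt.
  apply/andP; split.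
    rewrite -/(lo n) mulrC -ler_pdivlMr ?lo0 // -lerBrDl.
    by rewrite ge_min lexx orbT.
  rewrite -/(up n) mulrC -ler_pdivrMr ?up0 // -lerBlDl.
  by rewrite le_max lexx orbT.
Unshelve. all: by end_near.
Qed.
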